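(* Let $A_{pq}$, $q=1,\ldots,d_p$, $p=1,\ldots,k$, be a solution of the extremality equation (E) of the separable Kähler geometry associated with a Segre–Veronese factorization structure and $\beta\in\mathfrak h$. For fixed $p$, let $\bar O_p\subset\{1,\ldots,k\}\setminus\{p\}$ be the set of those $j$ for which $\deg_{x_{pq}}\langle\hat{\mathbf x}_j,\Gamma_j\rangle=1$, and $O_p\subset\bar O_p$ the set of those $j$ for which $\Gamma_j$ decomposes in grouped $p$-slots, $\Gamma_j=\mathrm{ins}_p\big((e_j^p)^{\otimes d_p}\otimes\tilde\Gamma_j\big)$ with $e_j^p\in W_p^*$. Then $$A_{pq}(x_{pq})=\frac{N_{pq}(x_{pq})}{\prod_{j\in O_p}\langle(1,x_{pq}),e_j^p\rangle^{d_j}},$$ where $N_{pq}$ is a polynomial such that $\deg(N_{pq})\le m+2-\sum_{j\in\bar O_p\setminus O_p}d_j$. Furthermore, if $\partial_{x_{pq}}\langle\mu,\beta\rangle=0$, then $\deg(N_{pq})\le\ell_p+2-\sum_{j\in\bar O_p\setminus O_p}d_j$.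
   Context: Segre–Veronese factorization structure. Let $m=d_1+\cdots+d_k$, $m\ge2$, $d_j\ge1$, $W_1,\dots,W_k$ 2-dimensional real vector spaces, $V^*=\bigotimes_{i=1}^k(W_i^* )^{\otimes d_i}$ with slots labelled $(i,r)$, $1\le r\le d_i$; the slots $(p,1),\dots,(p,d_p)$ are the grouped $p$-slots. $\mathrm{ins}_j$ denotes the linear map reordering tensor factors so that the first $d_j$ factors (from $(W_j^* )^{\otimes d_j}$) are put in the grouped $j$-slots (used also when some other group of slots is absent). Let $\Gamma_j\in\bigotimes_{r\ne j}(W_r^* )^{\otimes d_r}$ be non-zero tensors such that $\mathfrak h:=\sum_{j}\mathrm{ins}_j(S^{d_j}W_j^*\otimes\langle\Gamma_j\rangle)\subset V^*$ has dimension $m+1$; $\varphi:\mathfrak h\hookrightarrow V^*$ is the inclusion. For $k=1$ (Veronese) $\mathfrak h=S^mW^*$, $\Gamma_1=1$. (Necessarily $\Gamma_j\in\bigotimes_{r\ne j}S^{d_r}W_r^*$, so $\langle\hat{\mathbf x}_j,\Gamma_j\rangle$ and $\langle\mu,\beta\rangle$ below are symmetric in each group of variables.) Notation. Identify $W_i,W_i^*$ with $\mathbb R^2$, $\langle(u,v),(a,b)\rangle=ua+vb$. With real variables $x_{ir}$: $\mathbf x=\bigotimes_{i,r}(1,x_{ir})$, $\hat{\mathbf x}_i=\bigotimes_{j\ne i}\bigotimes_s(1,x_{js})$, $\langle\mu,\alpha\rangle=\langle\mathbf x,\varphi(\alpha)\rangle$ for $\alpha\in\mathfrak h$, $\Delta_{ir}=\prod_{s\ne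 r}(x_{ir}-x_{is})$ ($=1$ if $d_i=1$). Fix $0\neq\beta\in\mathfrak h$. A solution of the extremality equation is a family of smooth non-vanishing functions $A_{ir}$ of one variable, $A_{ir}$ defined on an open interval $I_{ir}$ (with $\Delta_{ir},\langle\hat{\mathbf x}_i,\Gamma_i\rangle,\langle\mu,\beta\rangle$ non-vanishing on $\prod I_{ir}$), such that for some $\alpha\in\mathfrak h$ $$\text{(E)}\quad\sum_{i=1}^k\sum_{r=1}^{d_i}\frac{\langle\mu,\beta\rangle^{m+3}}{\Delta_{ir}\langle\hat{\mathbf x}_i,\Gamma_i\rangle\prod_{b=1}^k\langle\hat{\mathbf x}_b,\Gamma_b\rangle^{d_b}}\partial_{x_{ir}}^2\Big(\frac{A_{ir}(x_{ir})}{\langle\mu,\beta\rangle^{m+1}}\prod_{j=1}^k\langle\hat{\mathbf x}_j,\Gamma_j\rangle^{d_j}\Big)=\langle\mu,\alpha\rangle .$$ Definition of $\ell_p$. Multiply (E) by $\Delta_{pq}\prod_{b}\langle\hat{\mathbf x}_b,\Gamma_b\rangle^{d_b}$ to obtain $$\sum_{i,r}\frac{\Delta_{pq}}{\Delta_{ir}}\langle\mu,\beta\rangle^{m+3}\langle\hat{\mathbf x}_i,\Gamma_i\rangle^{d_i-1}\partial_{x_{ir}}^2\Big(\frac{A_{ir}(x_{ir})}{\langle\mu,\beta\rangle^{m+1}}\prod_{b\ne i}\langle\hat{\mathbf x}_b,\Gamma_b\rangle^{d_b}\Big)=\langle\mu,\alpha\rangle\Delta_{pq}\prod_{b}\langle\hat{\mathbf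 x}_b,\Gamma_b\rangle^{d_b}$$ (with $\prod_{b=1}^1\langle\hat{\mathbf x}_b,\Gamma_b\rangle^{d_b}=1$ for $k=1$). Then $\ell_p$ is the maximum of the $x_{pq}$-degrees of the coefficients at $A_{ir},A_{ir}',A_{ir}''$, $(i,r)\neq(p,q)$, and of the right-hand side for general $\alpha\in\mathfrak h$; it does not depend on $q$. *)

(* Defs.v *)
From mathcomp Require Import all_boot all_order all_algebra.
From mathcomp Require Import fingroup perm ring.
From mathcomp Require Import boolp classical_sets reals topology normedtype derive.
From mathcomp Require mpoly.
Import -(notations) mpoly.
Set Implicit Arguments.
Unset Strict Implicit.
Unset Printing Implicit Defensive.
Import Order.TTheory GRing.Theory Num.Theory.
Import numFieldNormedType.Exports.
Local Open Scope classical_set_scope.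
Local Open Scope ring_scope.

(* Tensors with finite slot set [S], each slot carrying the dual of R^2: [T f]
   is the coordinate on the basis tensor whose s-th factor is the f(s)-th
   vector of the standard basis. *)
Notation tensor R S := {ffun {ffun S -> 'I_2} -> R^o}.

Section Slots.
Variables (S : finType) (k : nat) (lab : S -> 'I_k).

Definition grp (p : 'I_k) : finType := {s : S | lab s == p}.
Definition rest (p : 'I_k) : finType := {s : S | lab s != p}.

(* Slots are named rather than ordered, so that reordering the tensor factors
   amounts to multiplying coordinates. *)
Definition ins (R : realType) (p : 'I_k)
    (T : tensor R (grp p)) (U : tensor R (rest p)) : tensor R S :=
  [ffun f : {ffun S -> 'I_2} => T [ffun s => f (val s)] * U [ffun s => f (val s)]].

End Slots.

Definition symtensor (R : realType) (S : finType) : {vspace tensor R S} :=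
  (\bigcap_(g : {perm S}) fixedSpace (linfun (fun T : tensor R S =>
     [ffun f : {ffun S -> 'I_2} => T [ffun s => f (g s)]] : tensor R S)))%VS.

Definition tpow (R : realType) (S : finType) (e : 'rV[R]_2) : tensor R S :=
  [ffun f : {ffun S -> 'I_2} => \prod_s e ord0 (f s)].

Section Factorization.
Variables (R : realType) (k : nat) (d : 'I_k -> nat).

Definition slot : finType := {i : 'I_k & 'I_(d i)}.
Definition grpof (s : slot) : 'I_k := tag s.

Definition dsum : nat := (\sum_(i < k) d i)%N.

Definition factors : Type := forall j : 'I_k, tensor R (rest grpof j).

Definition hspace (Gam : factors) : {vspace tensor R slot} :=
  (\sum_(j < k)
     linfun (fun T : tensor R (grp grpof j) => ins T (Gam j))
       @: symtensor R (grp grpof j))%VS.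

Definition segre_veronese (Gam : factors) : Prop :=
  [/\ (2 <= dsum)%N,
      forall j, (1 <= d j)%N,
      forall j, Gam j != 0,
      \dim (hspace Gam) = dsum.+1 &
      k = 1%N -> forall j, Gam j = [ffun=> 1]].

Notation Poly := (mpoly #|slot| R).
Definition var (s : slot) : Poly := mpolyX R (mnm1 (enum_rank s)).
Definition pderiv (s : slot) (P : Poly) : Poly := mderiv (enum_rank s) P.
Definition peval (P : Poly) (x : slot -> R) : R :=
  meval (fun i => x (enum_val i)) P.

(* Degree in the variable x_s; it is 0 for the zero polynomial. *)
Definition pdeg (s : slot) (P : Poly) : nat :=
  \max_(m <- msupp P) m (enum_rank s).

(* < (1, x_s) (x) ... , T > for a tensor T on the slots embedded by [emb]. *)
Definition pairing (S : finType) (emb : S -> slot) (T : tensor R S) : Poly :=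
  \sum_(f : {ffun S -> 'I_2})
    (T f : R) *: \prod_s (if f s == ord0 then 1 else var (emb s)).

Definition mu (a : tensor R slot) : Poly := pairing id a.

Definition Delta (s : slot) : Poly :=
  \prod_(t | (grpof t == grpof s) && (t != s)) (var s - var t).

Section Equation.
Variables (Gam : factors) (beta : tensor R slot).

Definition xGam (j : 'I_k) : Poly := pairing val (Gam j).

Definition extremality_equation (A : slot -> R -> R) (alpha : tensor R slot)
    (x : slot -> R) : Prop :=
  \sum_(s : slot)
    peval (mu beta) x ^+ (dsum + 3) /
      (peval (Delta s) x * peval (xGam (grpof s)) x *
       \prod_b peval (xGam b) x ^+ d b) *
    derive1n 2 (fun t => let y := [eta x with s |-> t] in
      A s t / peval (mu beta) y ^+ (dsum + 1) *
      \prod_j peval (xGam j) y ^+ d j) (x s)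
  = peval (mu alpha) x.

Definition extremal_solution (I : slot -> set R) (A : slot -> R -> R) : Prop :=
  [/\ forall s, [/\ open (I s), is_interval (I s) & I s !=set0],
      forall s t, I s t ->
        A s t != 0 /\ forall n, derivable (derive1n n (A s)) t 1,
      forall x : slot -> R, (forall s, I s (x s)) ->
        [/\ forall s, peval (Delta s) x != 0,
            forall i, peval (xGam i) x != 0 & peval (mu beta) x != 0] &
      exists2 alpha, alpha \in hspace Gam &
        forall x : slot -> R, (forall s, I s (x s)) ->
          extremality_equation A alpha x].

(* With B = <mu,beta> and P the product of the <x^_b,Gam_b>^(d_b) over the b
   different from the group of t, the coefficients at A, A', A'' (in this
   order) in B^(m+3) d^2/dx_t^2 (A(x_t) P / B^(m+1)); this is proved in
   [leibniz_coefsE]. *)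
Definition leibniz_coefs (t : slot) (B P : Poly) : seq Poly :=
  let B1 := pderiv t B in let B2 := pderiv t B1 in
  let P1 := pderiv t P in let P2 := pderiv t P1 in
  let m1 := (dsum + 1)%:R in let m2 := (dsum + 2)%:R in
  [:: B ^+ 2 * P2 - 2 * m1 * B * B1 * P1 - m1 * B * B2 * P
        + m1 * m2 * B1 ^+ 2 * P;
      2 * (B ^+ 2 * P1 - m1 * B * B1 * P);
      B ^+ 2 * P].

(* The coefficients in question are [Delta s / Delta t] times these
   polynomials; the division by [Delta t] is accounted for in [ell]. *)
Definition coefs (s t : slot) : seq Poly :=
  [seq Delta s * xGam (grpof t) ^+ (d (grpof t)).-1 * c
  | c <- leibniz_coefs t (mu beta) (\prod_(b | b != grpof t) xGam b ^+ d b)].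

Definition rhs (s : slot) (a : tensor R slot) : Poly :=
  mu a * Delta s * \prod_b xGam b ^+ d b.

(* The x_s-degree of a quotient is that of the numerator minus that of the
   denominator; here every quotient is a polynomial in x_s, so that truncated
   subtraction is harmless.  The degree of [rhs s a] for general a in h is its
   maximum over h, which is attained on any basis. *)
Definition ell (s : slot) : nat :=
  maxn (\max_(t : slot | t != s) \max_(c <- coefs s t)
          (pdeg s c - pdeg s (Delta t)))
       (\max_(a <- vbasis (hspace Gam)) pdeg s (rhs s a)).

Definition Obar (s : slot) : {set 'I_k} :=
  [set j | (j != grpof s) && (pdeg s (xGam j) == 1%N)].

(* The p-slots of Gam_j are those labelled p among the slots outside group j. *)
Definition decomposes_with (p j : 'I_k) (e : 'rV[R]_2) : Prop :=
  exists U : tensor R (rest (fun t : rest grpof j => grpof (val t)) p),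
    Gam j = ins (tpow _ e) U.

Definition Oset (s : slot) : {set 'I_k} :=
  [set j in Obar s | `[< exists e, decomposes_with (grpof s) j e >]].

End Equation.
End Factorization.

Section Leibniz.
Variables (R : realType) (k : nat) (d : 'I_k -> nat) (s : slot d).
Implicit Types (P Q B : mpoly #|slot d| R) (x : slot d -> R) (t : R).

Lemma peval_is_derive Q x t :
  is_derive t 1 (fun u => peval Q [eta x with s |-> u])
    (peval (pderiv s Q) [eta x with s |-> t]).
Proof.
pose ev (u : R) (q : mpoly #|slot d| R) : R := peval q [eta x with s |-> u].
pose K q := is_derive t 1 (fun u => ev u q) (ev t (mderiv (enum_rank s) q)).
have Kext q (f : R -> R) l : is_derive t 1 f l -> (forall u, ev u q = f u) ->
    ev t (mderiv (enum_rank s) q) = l -> K q.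
  by move=> fl qf ql; rewrite /K ql; rewrite (funext qf : (fun u => ev u q) = f).
have KC c : K (mpolyC _ c).
  apply: (Kext _ _ _ (is_derive_cst c t 1)) => [u|]; first exact: mevalC.
  by rewrite mderivC /ev /peval meval0.
have KD p q : K p -> K q -> K (p + q).
  move=> hp hq; apply: (Kext _ _ _ (is_deriveD hp hq)) => [u|].
    by rewrite /ev /peval mevalD.
  by rewrite mderivD /ev /peval mevalD.
have KM p q : K p -> K q -> K (p * q).
  move=> hp hq; apply: (Kext _ _ _ (is_deriveM hp hq)) => [u|].
    by rewrite /ev /peval mevalM.
  by rewrite mderivM /ev /peval mevalD !mevalM /GRing.scale /= addrC [X in _ + X]mulrC.
have KX i : K (mpolyX R (mnm1 i)).
  have [->|ni] := eqVneq i (enum_rank s).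
    apply: (Kext _ _ _ (is_derive_id t 1)) => [u|].
      by rewrite /ev /peval mevalXU enum_rankK /= eqxx.
    rewrite mderivX mnm1E eqxx /ev /peval mevalZ mul1r.
    by rewrite -[X in mnm_sub X _]add0m addmK mpolyX0 meval1.
  apply: (Kext _ _ _ (is_derive_cst (x (enum_val i)) t 1)) => [u|].
    rewrite /ev /peval mevalXU /= ifN //.
    by apply: contra ni => /eqP <-; rewrite enum_valK.
  by rewrite mderivX mnm1E (negbTE ni) /ev /peval mevalZ mul0r.
suff : K Q by [].
elim/mpolyind: Q => [|c m p _ _ IH]; first by rewrite -mpolyC0; exact: (KC).
apply: (KD) => //; rewrite -mul_mpolyC; apply: (KM); first exact: (KC).
rewrite mpolyXE_id; apply: (big_ind K) => [||i _].
- by rewrite -mpolyC1; exact: (KC).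
- exact: (KM).
elim: (m i) => [|n IHn]; first by rewrite expr0 -mpolyC1; exact: (KC).
by rewrite exprS; apply: (KM).
Qed.

Lemma leibniz_coefsE B P (a : R -> R) x :
  peval B x != 0 ->
  (\forall t \near x s, derivable a t 1) ->
  derivable (derive1 a) (x s) 1 ->
  let c n := peval (leibniz_coefs s B P)`_n x in
  peval B x ^+ (dsum d + 3) *
    derive1n 2 (fun t => let y := [eta x with s |-> t] in
      a t / peval B y ^+ (dsum d + 1) * peval P y) (x s)
  = c 0%N * a (x s) + c 1%N * (derive1 a) (x s) + c 2%N * derive1n 2 a (x s).
Proof.
move=> B0 da dda c.
have xs : [eta x with s |-> x s] =1 x by move=> i /=; case: eqP => // ->.
have ev Q : peval Q [eta x with s |-> x s] = peval Q x.
  by rewrite /peval; apply: meval_eq => i; exact: xs.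
pose f Q t := peval Q [eta x with s |-> t].
have df Q t : is_derive t 1 (f Q) (f (pderiv s Q) t) by exact: peval_is_derive.
pose n := (dsum d + 1)%N.
pose b t := (f B t ^+ n)^-1.
pose g t := a t * b t * f P t.
have fB : \forall t \near x s, f B t != 0.
  have : {for x s, continuous (f B)}.
    by apply: differentiable_continuous; apply/derivable1_diffP; case: (df B (x s)).
  move=> /(_ [set y | y != 0]); apply.
  by apply: open_nbhs_nbhs; split; [exact: open_neq | rewrite /= /f ev].
have dM (u v : R -> R) (t du dv : R) : is_derive t 1 u du -> is_derive t 1 v dv ->
    is_derive t 1 (fun y => u y * v y) (du * v t + u t * dv).
  move=> hu hv; have h := is_deriveM hu hv.
  by apply: is_derive_eq h _; rewrite /GRing.scale /= addrC [v t * _]mulrC.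
have dX m t : is_derive t 1 (fun u => f B u ^+ m)
    (m%:R * f B t ^+ m.-1 * f (pderiv s B) t).
  elim: m => [|m IHm].
    rewrite !mul0r; exact: (is_derive_cst (1 : R)).
  rewrite (_ : (fun u => f B u ^+ m.+1) = fun u => f B u * f B u ^+ m); last first.
    by apply/funext => u; rewrite exprS.
  apply: is_derive_eq (dM _ _ _ _ _ (df B t) IHm) _.
  case: m {IHm} => [|m]; first by rewrite /= expr0; ring.
  by rewrite /= exprS -[m.+2]addn1 natrD; ring.
have dV (u : R -> R) (t du : R) : is_derive t 1 u du -> u t != 0 ->
    is_derive t 1 (fun y => (u y)^-1) (- du / u t ^+ 2).
  move=> hu u0; have hd : derivable u t 1 by case: hu.
  apply: DeriveDef; first exact: derivableV.
  by rewrite deriveV // derive_val /GRing.scale /= mulNr mulrC mulNr.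
have db m t : f B t != 0 -> is_derive t 1 (fun u => (f B u ^+ m)^-1)
    (- m%:R * f (pderiv s B) t * (f B t ^+ m.+1)^-1).
  move=> Bt; apply: is_derive_eq (dV _ _ _ (dX m t) _) _; first exact: expf_neq0.
  case: m => [|m]; first by rewrite !mul0r oppr0 !mul0r.
  rewrite /= !exprS; field.
  by rewrite Bt expf_neq0.
have dD (u v : R -> R) (t du dv : R) : is_derive t 1 u du -> is_derive t 1 v dv ->
    is_derive t 1 (fun y => u y + v y) (du + dv).
  by move=> hu hv; exact: is_deriveD hu hv.
have d1 (u : R -> R) (t l : R) : is_derive t 1 u l -> (derive1 u) t = l.
  by move=> h; rewrite derive1E derive_val.
have dd1 (u : R -> R) (t : R) : derivable u t 1 -> is_derive t 1 u ((derive1 u) t).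
  by move=> h; rewrite derive1E; exact/derivableP.
pose B1 := pderiv s B; pose P1 := pderiv s P.
pose b' t := - n%:R * f B1 t * (f B t ^+ n.+1)^-1.
pose g' t := ((derive1 a) t * b t + a t * b' t) * f P t + a t * b t * f P1 t.
have dg : \forall t \near x s, g' t = (derive1 g) t.
  near=> t.
  have at1 : is_derive t 1 a (derive1 a t) by apply: (dd1); near: t.
  have bt1 : is_derive t 1 b (b' t) by apply: (db); near: t.
  have gt1 : is_derive t 1 g (g' t) := dM _ _ _ _ _ (dM _ _ _ _ _ at1 bt1) (df P t).
  exact: esym (d1 g t (g' t) gt1).
have Bx : f B (x s) != 0 by rewrite /f ev.
have dax : is_derive (x s) 1 a ((derive1 a) (x s)) by apply: (dd1); exact: nbhs_singleton da.
have da'x := dd1 _ _ dda.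
have bx : is_derive (x s) 1 b (b' (x s)) by exact: db.
have db'x := dM _ _ _ _ _ (dM _ _ _ _ _ (is_derive_cst (- n%:R : R) (x s) 1)
  (df B1 (x s))) (db n.+1 _ Bx).
have dg' := dD _ _ _ _ _
  (dM _ _ _ _ _ (dD _ _ _ _ _ (dM _ _ _ _ _ da'x bx) (dM _ _ _ _ _ dax db'x))
     (df P (x s)))
  (dM _ _ _ _ _ (dM _ _ _ _ _ dax bx) (df P1 (x s))).
have -> : derive1n 2 (fun t => let y := [eta x with s |-> t] in
      a t / peval B y ^+ (dsum d + 1) * peval P y) (x s) = derive1 (derive1 g) (x s) by [].
rewrite (d1 _ _ _ (near_eq_is_derive dg dg')).
have -> : derive1n 2 a (x s) = derive1 (derive1 a) (x s) by [].
have n2 : (dsum d + 2 = n.+1)%N by rewrite /n !addnS.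
have n3 : (dsum d + 3 = n.+2)%N by rewrite /n !addnS.
rewrite /c /leibniz_coefs /= n2 -/n.
have E Q : f Q (x s) = peval Q x by rewrite /f ev.
rewrite /b /b' !E.
have pM Q1 Q2 : peval (Q1 * Q2) x = peval Q1 x * peval Q2 x by exact: mevalM.
have pD Q1 Q2 : peval (Q1 + Q2) x = peval Q1 x + peval Q2 x by exact: mevalD.
have pN Q : peval (- Q) x = - peval Q x by exact: mevalN.
have pn i : peval i%:R x = i%:R by rewrite /peval rmorph_nat.
rewrite !expr2 !(pM, pD, pN, pn) -/B1 -/P1.
have p1 : peval 1 x = 1 by rewrite /peval meval1.
rewrite !p1 -/n n3 !exprS /functions.cst /= -[n.+1]addn1 !natrD.
have w0 : peval B x ^+ n != 0 by rewrite expf_neq0.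
move: (peval B x ^+ n) w0 B0 => w w0 B0.
by field; rewrite w0 B0.
Unshelve. all: by end_near.
Qed.
End Leibniz.

(* Main.v *)
From HB Require Import structures.
Require Import Defs.
From mathcomp Require Import all_boot all_order all_algebra.
From mathcomp Require Import fingroup perm ring lra zify.
From mathcomp Require Import boolp classical_sets reals topology normedtype derive.
From mathcomp Require mpoly.
Import -(notations) mpoly.
Set Implicit Arguments.
Unset Strict Implicit.
Unset Printing Implicit Defensive.
Import Order.TTheory GRing.Theory Num.Theory.
Import numFieldNormedType.Exports.
Local Open Scope ring_scope.

(* Write G_j for the pairing of Gamma_j, b for that of beta, and freeze all
   variables except x = x_s.  Then (E) says that F = A_s * prod_(j != p) G_j^(d_j)
   satisfies  b^2 F'' - 2 n b b' F' + n (n + 1) b'^2 F = Q  with n = m + 1 and Q a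
   polynomial of degree at most ell_p <= m.  As b is affine in x, differentiating
   n times gives b^2 F^(n+2) = 0, so F is a polynomial of degree at most m + 2;
   when b does not depend on x, F'' = Q / b^2 gives the bound ell_p + 2.
   For j in O_p the x-dependent factor of G_j is the fixed form of e_j.  For j in
   Obar_p \ O_p the root of G_j in x moves with the frozen variables, since a
   fixed root would, by the symmetry of Gamma_j in the p-slots, split Gamma_j.
   Comparing F at two generic choices of the frozen variables, the products of
   these moving factors are coprime, so they divide F. *)

(** * Differential equations with polynomial solutions *)

Section Univariate.
Local Open Scope classical_set_scope.
Local Open Scope ring_scope.
Variables (R : realType).
Implicit Types (I : set R) (f g : R -> R) (p q : {poly R}).

(** The operator is b^(n+2) (F / b^n)''. After j derivations its two lower-order coefficients are 2
    (j - n) and (j - n)(j - n - 1), which is why n derivations isolate the top term. The bound deg Q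
    <= m < n is what then makes F a polynomial. It has to be earned: the terms of the equation at
    slots t other than s carry 1 / Delta_t, and the factor of Delta_t that contains x_s has to
    cancel against Delta_s before these terms become polynomials in x_s.

    The symmetry of the Gamma_j is not among the hypotheses. It is forced by dim h = m + 1 together
    with Gamma_j <> 0, through a dimension count.

    All generic points must lie in the box of intervals on which the equation holds. They are found
    along segments, where it is enough to avoid the finitely many roots of a univariate
    polynomial. *)

Lemma is_derive_horner p (x : R) : is_derive x 1 (horner p) (p^`()).[x].
Proof.
by apply: DeriveDef; [exact: derivable_horner | rewrite derivE derive1E].
Qed.

Lemma is_derive_mul f g (x df dg : R) : is_derive x 1 f df ->
  is_derive x 1 g dg -> is_derive x 1 (fun t => f t * g t) (df * g x + f x * dg).
Proof.
move=> hf hg; apply: is_derive_eq (is_deriveM hf hg) _.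
by rewrite /GRing.scale /= addrC [g x * _]mulrC.
Qed.

Lemma is_derive_add f g (x df dg : R) : is_derive x 1 f df ->
  is_derive x 1 g dg -> is_derive x 1 (fun t => f t + g t) (df + dg).
Proof. by move=> hf hg; exact: is_deriveD. Qed.

Lemma poly_eq0_itv p (a b : R) :
  a < b -> (forall t, a < t < b -> p.[t] = 0) -> p = 0.
Proof.
move=> ab p0; apply/eqP/negPn/negP => pN0.
(* Pairwise distinct points strictly inside the interval; the denominator starts at 2, so that [b]
   itself is avoided. *)
pose u i : R := a + (b - a) / i.+2%:R.
pose rs := map u (iota 0 (size p)).
have ba : 0 < b - a by rewrite subr_gt0.
have rootrs : all (root p) rs.
  apply/allP => _ /mapP[i _ ->]; apply/eqP/p0.
  rewrite /u ltrDl divr_gt0 //=.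
  by rewrite -ltrBrDl ltr_pdivrMr // ltr_pMr // ltr1n.
have urs : uniq rs.
  rewrite map_inj_uniq ?iota_uniq // => i j /addrI /(mulfI (lt0r_neq0 ba)).
  by move=> /invr_inj /eqP; rewrite eqr_nat => /eqP[].
by have := max_poly_roots pN0 rootrs urs; rewrite size_map size_iota ltnn.
Qed.

Lemma open_interval_itv I : open I -> I !=set0 ->
  exists a b : R, a < b /\ forall t, a < t < b -> I t.
Proof.
move=> oI [x Ix].
have /nbhs_ballP[e e0 be] : nbhs x I by exact: open_nbhs_nbhs.
exists (x - e), (x + e); split; first by have : 0 < e := e0; lra.
by move=> t ?; apply: be; rewrite /ball /= ltr_norml; lra.
Qed.

Lemma poly_eq_open I p q : open I -> I !=set0 ->
  (forall t, I t -> p.[t] = q.[t]) -> p = q.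
Proof.
move=> oI /(open_interval_itv oI)[a [b [ab abI]]] pq.
apply/subr0_eq/(poly_eq0_itv ab) => t /abI It.
by rewrite hornerD hornerN pq // subrr.
Qed.

Lemma is_derive_eq_open I f g (x l : R) : open I -> I x ->
  (forall t, I t -> f t = g t) -> is_derive x 1 f l -> is_derive x 1 g l.
Proof.
move=> oI Ix fg df; apply: near_eq_is_derive df.
by apply: filterS (open_nbhs_nbhs (conj oI Ix)) => t /fg.
Qed.

Lemma is_derive_inj f (x l l' : R) : is_derive x 1 f l -> is_derive x 1 f l' -> l = l'.
Proof. by move=> [_ <-] [_ <-]. Qed.

Lemma is_derive0_itv I f : is_interval I ->
  (forall t, I t -> is_derive t 1 f 0) ->
  forall x y, I x -> I y -> f x = f y.
Proof.
move=> iI f0 x y Ix Iy; wlog xy : x y Ix Iy / x <= y.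
  by move=> h; case: (leP x y) => [|/ltW] xy; [|apply: esym]; apply: h.
move: xy; rewrite le_eqVlt => /predU1P[-> //|xy].
have Ixy t : x <= t <= y -> I t by exact: iI.
have [||c _] := @MVT R f (fun=> 0) x y xy.
- move=> t; rewrite in_itv /= => /andP[xt ty].
  by apply: f0; apply: Ixy; rewrite (ltW xt) (ltW ty).
- apply: derivable_within_continuous => t; rewrite in_itv /= => txy.
  by case: (f0 t (Ixy _ txy)).
- by rewrite mul0r => /eqP; rewrite subr_eq0 => /eqP ->.
Qed.

(** At i = 0 the quotient is a division by 0, hence 0: this is the primitive without constant
    term. *)
Definition antideriv p : {poly R} := \poly_(i < (size p).+1) (p`_i.-1 / i%:R).

Lemma antiderivK p : (antideriv p)^`() = p.
Proof.
apply/polyP => i; rewrite coef_deriv coef_poly ltnS /=.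
have [ip|pi] := ltnP; last by rewrite mul0rn nth_default.
by rewrite -[LHS]mulr_natr divfK // pnatr_eq0.
Qed.

Lemma is_derive_poly_itv I f p : is_interval I -> open I -> I !=set0 ->
  (forall t, I t -> is_derive t 1 f p.[t]) ->
  exists2 q : {poly R}, (size q <= (size p).+1)%N & forall t, I t -> f t = q.[t].
Proof.
move=> iI oI [x0 Ix0] fp; pose q0 := antideriv p.
have szq : (size q0 <= (size p).+1)%N by exact: size_poly.
exists (q0 + (f x0 - q0.[x0])%:P).
  rewrite (leq_trans (size_polyD _ _)) // geq_max szq /=.
  by rewrite (leq_trans (size_polyC_leq1 _)).
move=> t It; rewrite hornerD hornerC.
have fq0 u : I u -> is_derive u 1 (fun t => f t - q0.[t]) 0.
  move=> Iu; have := is_deriveB (fp u Iu) (is_derive_horner q0 u).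
  by rewrite antiderivK subrr.
by rewrite -(is_derive0_itv iI fq0 It Ix0) addrC subrK.
Qed.

(** The successive derivatives are carried as a family constrained on [I] only, where smoothness is
    known; a product then receives an explicit family instead of an iterated [derive1n]. *)
Definition derivs_on I f (F : nat -> R -> R) : Prop :=
  (forall x, I x -> F 0%N x = f x) /\
  forall n x, I x -> is_derive x 1 (F n) (F n.+1 x).

Lemma derivs_on_poly I f F n p : is_interval I -> open I -> I !=set0 ->
  derivs_on I f F -> (forall x, I x -> F n x = p.[x]) ->
  exists2 q : {poly R}, (size q <= size p + n)%N & forall t, I t -> f t = q.[t].
Proof.
move=> iI oI I0 [F0 FS] Fn.
have [q sq Fq] : exists2 q : {poly R},
    (size q <= size p + n)%N & forall t, I t -> F 0%N t = q.[t].
  elim: n p Fn => [|n IH] p Fn; first by exists p; rewrite // addn0.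
  have [|q sq Fq] := @is_derive_poly_itv I (F n) p iI oI I0.
    by move=> t It; rewrite -Fn //; exact: FS.
  have [r sr Fr] := IH q Fq; exists r => //.
  by rewrite (leq_trans sr) // addnS -addSn leq_add2r.
by exists q => // t It; rewrite -F0 // Fq.
Qed.

Lemma derivs_on_mul I f F p : derivs_on I f F ->
  exists G, derivs_on I (fun t => f t * p.[t]) G.
Proof.
move=> [F0 FS]; elim/poly_ind: p => [|p c [G [G0 GS]]].
  exists (fun _ _ => 0); split => [x _|n x _]; first by rewrite horner0 mulr0.
  exact: is_derive_cst.
(* Leibniz rule for x g + c f, with g the product by the shorter polynomial. At n = 0 the truncated
   index [n.-1] is multiplied by 0. *)
exists (fun n x => x * G n x + n%:R * G n.-1 x + c * F n x); split => [x Ix|n x Ix].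
  by rewrite F0 // G0 // hornerMXaddC mul0r addr0; ring.
have dG m := GS m x Ix; have dF := FS n x Ix.
have d1 : is_derive x 1 (fun x => x * G n x) (x * G n.+1 x + G n x * 1).
  exact: is_deriveM (is_derive_id x 1) (dG n).
have d2 : is_derive x 1 (fun x => n%:R * G n.-1 x) (n%:R * G n x).
  case: n {dF d1} => [|n].
    have -> : (fun x => 0%:R * G 0.-1 x) = fun=> 0 by apply/funext => y; rewrite mul0r.
    rewrite mul0r; exact: is_derive_cst.
  exact: is_deriveZ (dG n).
have d3 : is_derive x 1 (fun x => c * F n x) (c * F n.+1 x) by exact: is_deriveZ dF.
apply: is_derive_eq (is_deriveD (is_deriveD d1 d2) d3) _.
by rewrite /= -[n.+1%:R]natr1; ring.
Qed.

(* Differentiating [b^2 f'' - 2 n b b' f' + n (n + 1) b'^2 f] exactly [n]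
   times leaves only [b^2 f^(n+2)], since [b] is affine. *)
Lemma derivs_on_ode I f F (b0 b1 : R) n Q : open I -> derivs_on I f F ->
  let b t := b0 + b1 * t in
  (forall t, I t -> b t ^+ 2 * F 2 t - 2 * n%:R * (b t * b1) * F 1 t
     + n%:R * (n%:R + 1) * b1 ^+ 2 * F 0 t = Q.[t]) ->
  forall t, I t -> b t ^+ 2 * F n.+2 t = Q^`(n).[t].
Proof.
move=> oI [_ FS] b ode.
(* The j-th derivative of the left-hand side, using b'' = 0. The last coefficient equals (j - n)(j -
   n - 1), so both lower-order terms vanish at j = n. *)
pose E j t := b t ^+ 2 * F j.+2 t + 2 * (j%:R - n%:R) * (b t * b1 * F j.+1 t)
   + (j%:R * (j%:R - 1) - 2 * n%:R * j%:R + n%:R * (n%:R + 1)) * (b1 ^+ 2 * F j t).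
suff EQ j : forall t, I t -> E j t = Q^`(j).[t].
  move=> t It; rewrite -EQ // /E subrr mulr0 mul0r addr0.
  rewrite [X in _ = _ + X * _](_ : _ = 0) ?mul0r ?addr0 //; ring.
elim: j => [|j IH] t It; first by rewrite -ode // /E; ring.
have db : is_derive t 1 b b1.
  have := is_deriveD (is_derive_cst b0 t 1) (is_deriveZ b1 (is_derive_id t 1)).
  by move=> /is_derive_eq; apply; rewrite add0r /GRing.scale /= mulr1.
have dC c := is_derive_cst (c : R) t 1.
have dE := is_derive_add (is_derive_add (is_derive_mul (is_derive_mul db db) (FS j.+2 t It))
  (is_derive_mul (dC (2 * (j%:R - n%:R))) (is_derive_mul (is_derive_mul db (dC b1)) (FS j.+1 t It))))
  (is_derive_mul (dC (j%:R * (j%:R - 1) - 2 * n%:R * j%:R + n%:R * (n%:R + 1)))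
    (is_derive_mul (dC (b1 ^+ 2)) (FS j t It))).
have dQ := is_derive_eq_open oI It (fun u Iu => esym (IH u Iu)) (is_derive_horner Q^`(j) t).
rewrite derivnS -(is_derive_inj (is_derive_eq dE erefl) dQ).
by rewrite /E /functions.cst -[j.+1%:R]natr1; ring.
Qed.

(** The hypothesis is b^(n+2) ((A p) / b^n)'' = Q, expanded in A, A', A''. Regrouped in terms of the
    product A p, it becomes the equation of [derivs_on_ode]; for constant b it reads (A p)'' = Q /
    b^2, and two integrations suffice. *)
Lemma ode_poly I (A : R -> R) (AF : nat -> R -> R) (b p Q : {poly R}) n :
  is_interval I -> open I -> I !=set0 -> derivs_on I A AF ->
  (size b <= 2)%N -> (size Q <= n)%N ->
  (forall t, I t -> b.[t] != 0) ->
  (forall t, I t ->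
     (b ^+ 2 * p^`()^`() - 2 * n%:R * b * b^`() * p^`()
        + n%:R * (n%:R + 1) * b^`() ^+ 2 * p).[t] * AF 0%N t
     + (2 * (b ^+ 2 * p^`() - n%:R * b * b^`() * p)).[t] * AF 1%N t
     + (b ^+ 2 * p).[t] * AF 2 t = Q.[t]) ->
  exists M : {poly R}, [/\ forall t, I t -> A t * p.[t] = M.[t],
    (size M <= n.+2)%N & b^`() = 0 -> (size M <= size Q + 2)%N].
Proof.
move=> iI oI I0 dA sb sQ bN0 ode.
have [G [G0 GS]] := derivs_on_mul p dA.
pose b0 := b`_0; pose b1 := b`_1.
have bE t : b.[t] = b0 + b1 * t.
  rewrite (horner_coef_wide _ sb) big_ord_recl big_ord1 /= expr0 mulr1 expr1.
  by [].
have b'E : b^`() = b1%:P.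
  apply/polyP => i; rewrite coef_deriv coefC; case: i => [|i] /=; first by rewrite mulr1n.
  by rewrite nth_default ?mul0rn // (leq_trans sb).
have G1 t : I t -> G 1%N t = AF 1%N t * p.[t] + AF 0%N t * p^`().[t].
  move=> It; move: (GS 0%N t It) => /is_derive_inj; apply.
  apply: (@is_derive_eq_open I (fun t => AF 0%N t * p.[t])) => //.
    by move=> u Iu; rewrite G0 //= -(proj1 dA).
  have := is_derive_mul (proj2 dA 0%N t It) (is_derive_horner p t).
  by move=> /is_derive_eq; apply.
have G2 t : I t -> G 2 t = AF 2 t * p.[t] + 2 * AF 1%N t * p^`().[t]
     + AF 0%N t * p^`()^`().[t].
  move=> It; move: (GS 1%N t It) => /is_derive_inj; apply.
  apply: (@is_derive_eq_open I (fun t => AF 1%N t * p.[t] + AF 0%N t * p^`().[t])) => //.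
    by move=> u Iu; rewrite G1.
  have := is_derive_add (is_derive_mul (proj2 dA 1%N t It) (is_derive_horner p t))
     (is_derive_mul (proj2 dA 0%N t It) (is_derive_horner p^`() t)).
  by move=> /is_derive_eq; apply; ring.
have odeG t : I t -> (b0 + b1 * t) ^+ 2 * G 2 t
     - 2 * n%:R * ((b0 + b1 * t) * b1) * G 1%N t
     + n%:R * (n%:R + 1) * b1 ^+ 2 * G 0%N t = Q.[t].
  move=> It; rewrite -ode // G2 // G1 // G0 // -(proj1 dA) // b'E -bE.
  have nE : n%:R = n%:R%:P :> {poly R} by rewrite polyC_natr.
  rewrite nE -[2]/(2%:R) -polyC_natr.
  rewrite !(hornerE, horner_exp) /=; ring.
have gn := derivs_on_ode oI (conj G0 GS) odeG.
have [M sM MA] : exists2 q : {poly R}, (size q <= n.+2)%N &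
    forall t, I t -> A t * p.[t] = q.[t].
  (* Since [Q] has size at most n, its n-th derivative is 0, and b has no zero on [I]: the
     derivative of order n + 2 of A p vanishes. *)
  have [|q sq Aq] := @derivs_on_poly I _ G n.+2 0 iI oI I0 (conj G0 GS).
    move=> t It; have := gn t It.
    rewrite derivn_poly0 // horner0 => /eqP.
    by rewrite mulf_eq0 -bE expf_eq0 (negbTE (bN0 _ It)) /= => /eqP.
  by exists q => //; rewrite size_poly0 in sq.
exists M; split => // b'0.
have b10 : b1 = 0 by apply/eqP; rewrite -polyC_eq0 -b'E b'0.
have b0N : b0 != 0.
  by case: I0 => t It; have := bN0 t It; rewrite bE b10 mul0r addr0.
have [|q sq Aq] := @derivs_on_poly I _ G 2 ((b0 ^+ 2)^-1 *: Q) iI oI I0 (conj G0 GS).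
  move=> t It; rewrite hornerZ -odeG // b10.
  by rewrite !mul0r !mulr0 expr0n /= !mul0r !(mulr0, mul0r) subr0 !addr0 mulKf // expf_neq0.
have -> : M = q by apply: (poly_eq_open oI I0) => t It; rewrite -MA // Aq.
by rewrite (leq_trans sq) // leq_add2r size_scale_leq.
Qed.

End Univariate.

(** * Restriction of polynomials to lines and to one variable *)

Local Open Scope classical_set_scope.
Local Open Scope ring_scope.

Lemma eta_with_id (T : eqType) (V : Type) (x : T -> V) (s : T) :
  ([eta x with s |-> x s] : T -> V) = x.
Proof. by apply/funext => u /=; case: eqP => // ->. Qed.

Section LinePolynomials.
Variables (R : realType) (T : Type).
Implicit Types (y z : T -> R) (f : (T -> R) -> R).

Definition segment y z (t : R) : T -> R := fun i => y i + t * (z i - y i).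

(** Genericity arguments only need this property, which passes easily to functions obtained by
    permuting or fixing variables and by taking differences. *)
Definition line_polynomial f := forall y z,
  exists u : {poly R}, forall t, f (segment y z t) = u.[t].

Definition convex_set (C : (T -> R) -> Prop) := forall y z t,
  C y -> C z -> 0 < t < 1 -> C (segment y z t).

Lemma segment0 y z : segment y z 0 = y.
Proof. by apply/funext => i; rewrite /segment mul0r addr0. Qed.

Lemma segment1 y z : segment y z 1 = z.
Proof. by apply/funext => i; rewrite /segment mul1r addrC subrK. Qed.

(** Induction on the list of functions. Join a point that is good for the earlier ones to a point
    that is good for the new one: on this segment each function is a univariate polynomial, non-zero
    at one of the two ends, so their product is non-zero at some 0 < t < 1. Convexity keeps that
    point in [C]. *)
Lemma line_polynomial_common_neq0 (J : finType) (F : J -> (T -> R) -> R) C :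
  convex_set C -> (exists y, C y) -> (forall j, line_polynomial (F j)) ->
  (forall j, exists2 x, C x & F j x != 0) ->
  exists2 x, C x & forall j, F j x != 0.
Proof.
move=> cC [y0 Cy0] lF FN0.
suff [x Cx Fx] : exists2 x, C x & {in enum J, forall j, F j x != 0}.
  by exists x => // j; apply: Fx; rewrite mem_enum.
elim: (enum J) => [|a l [x Cx Fx]]; first by exists y0.
have [z Cz Fz] := FN0 a.
have [u uE] := choice (fun j => lF j x z).
pose p := \prod_(j <- a :: l) u j.
have pN0 : p != 0.
  rewrite /p prodf_seq_neq0; apply/allP => j; rewrite inE /= => jal.
  apply/eqP => uj0; case/predU1P: jal => [ja|jl].
    by move: Fz; rewrite -ja -(segment1 x z) uE uj0 horner0 eqxx.
  by move: (Fx j jl); rewrite -(segment0 x z) uE uj0 horner0 eqxx.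
have [t t01 pt] : exists2 t, 0 < t < 1 & p.[t] != 0.
  apply: contrapT => np; move/eqP: pN0; apply.
  apply: (poly_eq0_itv (@ltr01 R)) => t t01; apply/eqP/negPn/negP => pt.
  by apply: np; exists t.
exists (segment x z t); first exact: cC.
move=> j jal; rewrite uE; apply: contraNneq pt => uj0.
move: jal; rewrite /p horner_prod => jal.
by rewrite prodf_seq_eq0; apply/hasP; exists j => //=; rewrite uj0.
Qed.

End LinePolynomials.

(** * Generic points in an open box *)

Section Box.
Local Open Scope classical_set_scope.
Local Open Scope ring_scope.
Variables (R : realType) (T : finType) (I : T -> set R).
Hypothesis oI : forall i, open (I i).
Hypothesis I0 : forall i, I i !=set0.

Lemma box_nonempty : exists y : T -> R, forall i, I i (y i).
Proof. by have [y Iy] := choice I0; exists y. Qed.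

Lemma box_convex : (forall i, is_interval (I i)) ->
  convex_set (fun y : T -> R => forall i, I i (y i)).
Proof.
move=> iI y z t Iy Iz /andP[t0 t1] i; have := iI i; rewrite /segment => ii.
have [yz|zy] := leP (y i) (z i).
  apply: (ii (y i) (z i)) => //; nra.
apply: (ii (z i) (y i)) => //; nra.
Qed.

(** From a point of the box move towards [z]. For small t > 0 the point stays in the box, and the
    polynomial along the line is not zero because it does not vanish at t = 1. *)
Lemma line_polynomial_box_neq0 (f : (T -> R) -> R) :
  line_polynomial f -> (exists z, f z != 0) ->
  exists2 y, (forall i, I i (y i)) & f y != 0.
Proof.
move=> lf [z fz]; have [y Iy] := box_nonempty.
have [u uE] := lf y z.
have [e e0 Ie] : exists2 e : R, 0 < e &
    forall t, 0 < t < e -> {in enum T, forall i, I i (segment y z t i)}.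
  elim: (enum T) => [|a l [e e0 Ie]]; first by exists 1.
  have /nbhs_ballP[r r0 rI] : nbhs (y a) (I a) by exact: open_nbhs_nbhs.
  have r0' : 0 < r := r0; pose D := `|z a - y a| + 1.
  have D0 : 0 < D by rewrite /D ltr_wpDl.
  exists (Num.min e (r / D)); first by rewrite lt_min e0 divr_gt0.
  move=> t; rewrite lt_min => /andP[t0 /andP[te tr]] i.
  rewrite inE => /predU1P[->|il]; last by apply: Ie; rewrite ?t0.
  apply: rI; rewrite /ball /= /segment opprD addrA subrr add0r normrN normrM.
  rewrite (gtr0_norm t0); rewrite ltr_pdivlMr // in tr; apply: le_lt_trans tr.
  by rewrite ler_pM2l // /D lerDl.
have uN0 : u <> 0.
  by move=> u0; move: fz; rewrite -(segment1 y z) uE u0 horner0 eqxx.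
have [t te ut] : exists2 t, 0 < t < e & u.[t] != 0.
  apply: contrapT => np; apply: uN0.
  apply: (poly_eq0_itv e0) => t te; apply/eqP/negPn/negP => ut.
  by apply: np; exists t.
exists (segment y z t); last by rewrite uE.
by move=> i; apply: Ie => //; rewrite mem_enum.
Qed.

End Box.

Section Degree.
Variables (R : realType) (k : nat) (d : 'I_k -> nat) (s : slot d).
Implicit Types (P Q : mpoly #|slot d| R) (y z : slot d -> R) (t : slot d).

Lemma pdeg_leP P n :
  reflect (forall m, m \in msupp P -> (m (enum_rank s) <= n)%N) (pdeg s P <= n)%N.
Proof.
apply: (iffP (bigmax_leqP_seq _ _ _ _)) => [h m mP|h m mP _]; last exact: h.
exact: h.
Qed.

Lemma pdeg_msupp P m : m \in msupp P -> (m (enum_rank s) <= pdeg s P)%N.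
Proof. by move: m; apply/pdeg_leP. Qed.

Lemma pdeg0 : pdeg s (0 : mpoly #|slot d| R) = 0%N.
Proof. by rewrite /pdeg msupp0 big_nil. Qed.

Lemma pdegC (c : R) : pdeg s (mpolyC _ c) = 0%N.
Proof.
apply/eqP; rewrite -leqn0; apply/pdeg_leP => m; rewrite msuppC.
by case: eqP => //= _; rewrite inE => /eqP ->; rewrite mnm0E.
Qed.

Lemma pdeg1 : pdeg s (1 : mpoly #|slot d| R) = 0%N.
Proof. by rewrite -mpolyC1 pdegC. Qed.

Lemma pdeg_nat n : pdeg s (n%:R : mpoly #|slot d| R) = 0%N.
Proof. by rewrite -mpolyC_nat pdegC. Qed.

Lemma pdegD_le P Q n : (pdeg s P <= n)%N -> (pdeg s Q <= n)%N -> (pdeg s (P + Q)%R <= n)%N.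
Proof.
move=> /pdeg_leP hP /pdeg_leP hQ; apply/pdeg_leP => m /msuppD_le.
by rewrite mem_cat => /orP[/hP|/hQ].
Qed.

Lemma pdegN P : pdeg s (- P) = pdeg s P.
Proof. by rewrite /pdeg (perm_big _ (msuppN P)). Qed.

Lemma pdegB_le P Q n : (pdeg s P <= n)%N -> (pdeg s Q <= n)%N -> (pdeg s (P - Q)%R <= n)%N.
Proof. by move=> hP hQ; apply: pdegD_le; rewrite ?pdegN. Qed.

Lemma pdegM_le P Q a b :
  (pdeg s P <= a)%N -> (pdeg s Q <= b)%N -> (pdeg s (P * Q)%R <= a + b)%N.
Proof.
move=> /pdeg_leP hP /pdeg_leP hQ; apply/pdeg_leP => m /msuppM_le.
by move=> /allpairsP[[m1 m2] /= [/hP h1 /hQ h2 ->]]; rewrite mnmDE leq_add.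
Qed.

Lemma pdegZ_le (c : R) P : (pdeg s (c *: P) <= pdeg s P)%N.
Proof. by apply/pdeg_leP => m /msuppZ_le; exact: pdeg_msupp. Qed.

Lemma pdegX_le P n a : (pdeg s P <= a)%N -> (pdeg s (P ^+ n)%R <= n * a)%N.
Proof.
move=> h; elim: n => [|n IH]; first by rewrite expr0 pdeg1.
by rewrite exprS mulSn pdegM_le.
Qed.

Lemma pdeg_sum_le (J : Type) (r : seq J) (A : pred J) (F : J -> mpoly #|slot d| R) n :
  (forall j, A j -> (pdeg s (F j) <= n)%N) -> (pdeg s (\sum_(j <- r | A j) F j)%R <= n)%N.
Proof.
move=> h; apply: (big_ind (fun Q => pdeg s Q <= n)%N) => //.
  by rewrite pdeg0.
by move=> P Q; exact: pdegD_le.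
Qed.

Lemma pdeg_prod_le (J : Type) (r : seq J) (A : pred J) (F : J -> mpoly #|slot d| R)
    (n : J -> nat) :
  (forall j, A j -> (pdeg s (F j) <= n j)%N) ->
  (pdeg s (\prod_(j <- r | A j) F j)%R <= \sum_(j <- r | A j) n j)%N.
Proof.
move=> h; apply: (big_ind2 (fun Q m => pdeg s Q <= m)%N) => //.
  by rewrite pdeg1.
by move=> P a Q b; exact: pdegM_le.
Qed.

Lemma pdeg_var t : pdeg s (var R t) = (t == s).
Proof.
rewrite /pdeg /var msuppX big_seq1 mnm1E; congr nat_of_bool.
by rewrite (inj_eq enum_rank_inj).
Qed.

Lemma pdeg_pderiv_le t P : (pdeg s (pderiv t P) <= pdeg s P)%N.
Proof.
apply/pdeg_leP => m; rewrite mcoeff_msupp /pderiv mcoeff_deriv => mP.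
have /pdeg_msupp : mnm_add m (mnm1 (enum_rank t)) \in msupp P.
  by rewrite mcoeff_msupp; apply: contraNneq mP => ->; rewrite mul0rn.
by apply: leq_trans; rewrite mnmDE leq_addr.
Qed.

Definition upoly y P : {poly R} :=
  mmap (@polyC R) (fun i => if i == enum_rank s then 'X else (y (enum_val i))%:P) P.

Lemma horner_upoly y P x : (upoly y P).[x] = peval P [eta y with s |-> x].
Proof.
rewrite /upoly /mmap /peval mevalE horner_sum; apply: eq_bigr => m _.
rewrite hornerM hornerC /mmap1 horner_prod; congr (_ * _); apply: eq_bigr => i _.
rewrite horner_exp /=; congr (_ ^+ _).
have -> : (enum_val i == s) = (i == enum_rank s).
  by rewrite -(inj_eq enum_rank_inj) enum_valK.
by case: ifP => _; rewrite ?hornerX ?hornerC.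
Qed.

Lemma size_upoly_le y P : (size (upoly y P) <= (pdeg s P).+1)%N.
Proof.
rewrite /upoly /mmap; apply: (leq_trans (size_sum _ _ _)).
rewrite big_seq; apply: (big_ind (fun n => n <= _)%N) => //.
  by move=> a b; rewrite geq_max => -> ->.
move=> m /pdeg_msupp mP.
rewrite mul_polyC; apply: (leq_trans (size_scale_leq _ _)).
rewrite /mmap1 (bigD1 (enum_rank s)) //= eqxx.
rewrite (eq_bigr (fun i => (y (enum_val i) ^+ m i)%:P)); last first.
  by move=> i /negbTE ->; rewrite polyC_exp.
rewrite -rmorph_prod mulrC mul_polyC (leq_trans (size_scale_leq _ _)) //.
by rewrite size_polyXn.
Qed.

Lemma upolyM y P Q : upoly y (P * Q) = upoly y P * upoly y Q.
Proof. exact: rmorphM. Qed.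

Lemma upolyX y P n : upoly y (P ^+ n) = upoly y P ^+ n.
Proof. exact: rmorphXn. Qed.

(** Both sides compute the derivative of the same function of x_s, so they agree at infinitely many
    points. *)
Lemma upoly_pderiv y P : upoly y (pderiv s P) = (upoly y P)^`().
Proof.
apply/subr0_eq/(poly_eq0_itv (@ltr01 R)) => x _; apply/eqP.
rewrite hornerD hornerN subr_eq0 horner_upoly; apply/eqP.
move: (peval_is_derive s P y x) => /is_derive_inj; apply.
have -> : (fun u => peval P [eta y with s |-> u]) = horner (upoly y P).
  by apply/funext => u; rewrite horner_upoly.
exact: is_derive_horner.
Qed.

Lemma upoly_pdeg0 y P x : pdeg s P = 0%N -> upoly y P = (peval P [eta y with s |-> x])%:P.
Proof.
move=> P0; have := size_upoly_le y P; rewrite P0 => /size1_polyC Pc.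
by rewrite -horner_upoly Pc hornerC.
Qed.

Lemma peval_line_polynomial P : line_polynomial (peval P).
Proof.
move=> y z; exists (mmap (@polyC R) (fun i =>
  (y (enum_val i))%:P + (z (enum_val i) - y (enum_val i)) *: 'X) P) => t.
rewrite /mmap /peval mevalE horner_sum; apply: eq_bigr => m _.
rewrite hornerM hornerC /mmap1 horner_prod; congr (_ * _); apply: eq_bigr => i _.
by rewrite horner_exp !hornerE /segment mulrC.
Qed.

Lemma peval_eta_line_polynomial P (a : R) :
  line_polynomial (fun y => peval P [eta y with s |-> a]).
Proof.
move=> y z; have [u uE] := peval_line_polynomial P
  [eta y with s |-> a] [eta z with s |-> a].
exists u => b; rewrite -uE; congr (peval _ _); apply/funext => t.
by rewrite /segment /=; case: eqP => // _; rewrite subrr mulr0 addr0.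
Qed.

End Degree.

(** * Tensors as multilinear functions *)

Local Open Scope classical_set_scope.
Local Open Scope ring_scope.

Section Tensors.
Variables (R : realType).

Definition teval (S : finType) (T : tensor R S) (x : S -> R) : R :=
  \sum_(f : {ffun S -> 'I_2}) (T f : R) * \prod_u (if f u == ord0 then 1 else x u).

Lemma ord2_neq0 (i : 'I_2) : i != ord0 -> i = ord_max.
Proof. by move=> i0; apply: val_inj; case: i i0 => [[|[|]]]. Qed.

(** Choose [f] in the support of [T] with the fewest non-zero indices and evaluate at the 0-1 point
    it defines. Any other [g] in the support has a non-zero index where that of [f] is zero, so its
    monomial vanishes and only T f remains. *)
Lemma teval_eq0 (S : finType) (T : tensor R S) :
  (forall x, teval T x = 0) -> T = 0.
Proof.
move=> T0; apply/eqP/negPn/negP => TN0.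
have [f0 Tf0] : exists f, T f != 0.
  apply: contrapT => nf; move/eqP: TN0; apply; apply/ffunP => f; rewrite ffunE.
  by apply/eqP/negPn/negP => Tf; apply: nf; exists f.
have [f Tf fmin] := @arg_minnP _ f0 (fun f => T f != 0)
  (fun f : {ffun S -> 'I_2} => \sum_u (f u : nat))%N Tf0.
move/eqP: (T0 (fun u => (f u : nat)%:R)); apply/negP.
rewrite /teval (bigD1 f) //= [X in _ + X]big1 => [|g gf].
  rewrite addr0 big1 ?mulr1 // => u _; case: eqP => // /eqP /ord2_neq0 ->.
  by [].
have [->|Tg] := eqVneq (T g) 0; first by rewrite mul0r.
have [u fg] : exists u, (f u < g u)%N.
  apply: contrapT => nu; have le u : (g u <= f u)%N.
    by rewrite leqNgt; apply/negP => h; apply: nu; exists u.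
  have := fmin g Tg; rewrite leqNgt; move/negP; apply.
  have [u gfu] : exists u, g u != f u.
    apply: contrapT => nv; move/eqP: gf; apply; apply/ffunP => v.
    by apply/eqP/negPn/negP => gfv; apply: nv; exists v.
  rewrite [X in (X < _)%N](bigD1 u) //= [X in (_ < X)%N](bigD1 u) //=.
  rewrite -addSn leq_add //; last exact: leq_sum.
  by rewrite ltn_neqAle le andbT.
rewrite (bigD1 u) //=.
have gu : g u != ord0 by apply: contraTneq fg => ->.
have fu : f u = 0%N :> nat.
  by have := ltn_ord (g u); move: fg; case: (f u : nat) => // n; lia.
by rewrite (negbTE gu) fu mul0r mulr0.
Qed.

Lemma teval_linear (S : finType) (x : S -> R) a (T U : tensor R S) :
  teval (a *: T + U) x = a * teval T x + teval U x.
Proof.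
rewrite /teval mulr_sumr -big_split /=; apply: eq_bigr => f _.
by rewrite !ffunE mulrDl mulrA.
Qed.

Lemma teval0 (S : finType) (x : S -> R) : teval 0 x = 0.
Proof. by rewrite /teval big1 // => f _; rewrite ffunE mul0r. Qed.

Lemma teval_sum (S : finType) (x : S -> R) (J : Type) (r : seq J) (P : pred J)
    (T : J -> tensor R S) :
  teval (\sum_(j <- r | P j) T j) x = \sum_(j <- r | P j) teval (T j) x.
Proof.
apply: (big_morph (fun T : tensor R S => teval T x)); last exact: teval0.
by move=> U V; rewrite -[U]scale1r teval_linear mul1r scale1r.
Qed.

Lemma teval_perm (S : finType) (T : tensor R S) (g : {perm S}) (x : S -> R) :
  (forall f : {ffun S -> 'I_2}, T [ffun u => f (g u)] = T f) ->
  teval T (x \o g) = teval T x.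
Proof.
move=> Tg; rewrite /teval.
pose h (k : {perm S}) (f : {ffun S -> 'I_2}) : {ffun S -> 'I_2} := [ffun u => f (k u)].
have hK (k : {perm S}) : cancel (h k) (h k^-1%g).
  by move=> f; apply/ffunP => u; rewrite !ffunE permKV.
rewrite (reindex (h g)) /=.
  apply: eq_bigr => f _; rewrite Tg; congr (_ * _).
  rewrite [RHS](reindex_inj (@perm_inj _ g)); apply: eq_bigr => u _.
  by rewrite ffunE.
exists (h g^-1%g) => f _ //; first exact: hK.
by rewrite -{1}[g]invgK hK.
Qed.

Definition fset1 (S : finType) (u : S) (i : 'I_2) (f : {ffun S -> 'I_2}) :
  {ffun S -> 'I_2} := [ffun v => if v == u then i else f v].

(** [slice0] and [slice1] are the two coefficients of [teval T] as an affine function of x_u. They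
    stay on the slot set [S], supported where the index at u is [ord0], so that their values do not
    depend on x_u. *)
Definition slice0 (S : finType) (u : S) (T : tensor R S) : tensor R S :=
  [ffun f : {ffun S -> 'I_2} => if f u == ord0 then T f else 0].

Definition slice1 (S : finType) (u : S) (T : tensor R S) : tensor R S :=
  [ffun f : {ffun S -> 'I_2} => if f u == ord0 then T (fset1 u ord_max f) else 0].

Lemma teval_split (S : finType) (T : tensor R S) (u : S) (x : S -> R) :
  teval T x = teval (slice0 u T) x + x u * teval (slice1 u T) x.
Proof.
rewrite /teval (bigID (fun f : {ffun _} => f u == ord0)) /=; congr (_ + _).
  rewrite [RHS](bigID (fun f : {ffun _} => f u == ord0)) /= [X in _ + X]big1 ?addr0.
    by apply: eq_bigr => f fu; rewrite ffunE fu.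
  by move=> f /negbTE fu; rewrite ffunE fu mul0r.
rewrite mulr_sumr [RHS](bigID (fun f : {ffun _} => f u == ord0)) /=.
rewrite [X in _ = _ + X]big1 ?addr0; last first.
  by move=> f /negbTE fu; rewrite ffunE fu mul0r mulr0.
rewrite (reindex_onto (fset1 u ord_max) (fset1 u ord0)) /=; last first.
  move=> f /ord2_neq0 fu; apply/ffunP => v; rewrite !ffunE.
  by case: eqP => // ->.
apply: eq_big => [f|f].
  rewrite !ffunE eqxx /=; apply/eqP/eqP => [<-|fu]; first by rewrite !ffunE eqxx.
  by apply/ffunP => v; rewrite !ffunE; case: eqP => // ->.
case/andP => _ /eqP fE; have fu : f u = ord0 by rewrite -fE ffunE eqxx.
rewrite ffunE fu eqxx mulrCA; congr (_ * _).
rewrite (bigD1 u) //= ffunE eqxx /= [in RHS](bigD1 u) //= fu eqxx mul1r.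
by congr (_ * _); apply: eq_bigr => v /negbTE vu; rewrite ffunE vu.
Qed.

Section Slots.
Variables (S : finType) (k : nat) (lab : S -> 'I_k) (p : 'I_k).

Lemma teval_ins (T : tensor R (grp lab p)) (U : tensor R (rest lab p)) (x : S -> R) :
  teval (ins T U) x = teval T (fun u => x (val u)) * teval U (fun u => x (val u)).
Proof.
rewrite /teval big_distrlr /= pair_big /=.
pose h (f : {ffun S -> 'I_2}) : {ffun grp lab p -> 'I_2} * {ffun rest lab p -> 'I_2} :=
  ([ffun u => f (val u)], [ffun u => f (val u)]).
(* Every slot lies in one of the two subtypes, so the final [ord0] is never reached. *)
pose h' (fg : {ffun grp lab p -> 'I_2} * {ffun rest lab p -> 'I_2}) :
    {ffun S -> 'I_2} :=
  [ffun u => if insub u is Some v then fg.1 v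
             else if insub u is Some v then fg.2 v else ord0].
rewrite [RHS](reindex h) /=.
  apply: eq_bigr => f _; rewrite ffunE mulrACA; congr (_ * _).
  rewrite (bigID (fun u => lab u == p)) /=; congr (_ * _).
    rewrite (big_sub [pred u | lab u == p]) /=.
    by apply: eq_bigr => u _; rewrite ffunE.
  rewrite (big_sub [pred u | lab u != p]) /=.
  by apply: eq_bigr => u _; rewrite ffunE.
exists h' => [f _|[f g] _].
  apply/ffunP => u; rewrite !ffunE; case: insubP => [v _ <-|lu]; first by rewrite ffunE.
  by rewrite insubT /= ffunE.
congr pair; apply/ffunP => u; rewrite !ffunE.
  by rewrite valK.
rewrite insubN ?valK //; exact: (valP u).
Qed.

End Slots.

Lemma mem_symtensor (S : finType) (T : tensor R S) :
  (forall (g : {perm S}) (f : {ffun S -> 'I_2}), T [ffun u => f (g u)] = T f) ->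
  T \in symtensor R S.
Proof.
move=> Tg; rewrite memvE; apply/subv_bigcapP => g _; rewrite -memvE.
apply/fixedSpaceP.
pose h (T : tensor R S) : tensor R S :=
  [ffun f : {ffun S -> 'I_2} => T [ffun u => f (g u)]].
have hl : linear h by move=> a U V; apply/ffunP => f; rewrite !ffunE.
pose hm := GRing.isLinear.Build _ _ _ _ h hl.
pose hL : {linear _ -> _} := HB.pack h hm.
rewrite [LHS](lfunE hL); apply/ffunP => f; rewrite /= /h ffunE; exact: Tg.
Qed.

End Tensors.

Local Open Scope classical_set_scope.
Local Open Scope ring_scope.

(** * Pairings as polynomials: values, degrees, dimension count of the slots *)

Section Pairing.
Variables (R : realType) (k : nat) (d : 'I_k -> nat).
Implicit Types (x : slot d -> R).

Lemma peval_pairing (S : finType) (emb : S -> slot d) (T : tensor R S) x :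
  peval (pairing emb T) x = teval T (fun u => x (emb u)).
Proof.
rewrite /peval /pairing /teval rmorph_sum; apply: eq_bigr => f _.
rewrite /= mevalZ; congr (_ * _); rewrite rmorph_prod; apply: eq_bigr => u _ /=.
by case: ifP => _; rewrite ?meval1 // /var mevalXU enum_rankK.
Qed.

Lemma pdeg_pairing_le (S : finType) (emb : S -> slot d) (T : tensor R S) s :
  (pdeg s (pairing emb T) <= \sum_u (emb u == s))%N.
Proof.
apply: pdeg_sum_le => f _; apply: leq_trans (pdegZ_le _ _ _) _.
apply: pdeg_prod_le => u _; case: ifP => _; first by rewrite pdeg1.
by rewrite pdeg_var.
Qed.

Lemma pdeg_mu_le (a : tensor R (slot d)) s : (pdeg s (mu a) <= 1)%N.
Proof.
apply: leq_trans (pdeg_pairing_le _ _ _) _.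
by rewrite (bigD1 s) //= eqxx big1 // => u /negbTE ->.
Qed.

Lemma pdeg_xGam_le (Gam : factors R d) s j :
  (pdeg s (xGam Gam j) <= (j != grpof s))%N.
Proof.
apply: leq_trans (pdeg_pairing_le _ _ _) _; case: (eqVneq j (grpof s)) => [->|js].
  rewrite /= leqn0 big1 // => u _; case: eqP => // us.
  by have := valP u; rewrite /= us eqxx.
rewrite eq_sym in js; rewrite (bigD1 (exist _ s js : rest (@grpof k d) j)) //=.
rewrite eqxx big1 // => u us; case: eqP => // us'; move/eqP: us; case.
exact: val_inj.
Qed.

Lemma peval_xGam (Gam : factors R d) j x :
  peval (xGam Gam j) x = teval (Gam j) (fun u => x (val u)).
Proof. exact: peval_pairing. Qed.

Lemma eq_peval_xGam (Gam : factors R d) j x x' :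
  (forall u, grpof u != j -> x u = x' u) ->
  peval (xGam Gam j) x = peval (xGam Gam j) x'.
Proof.
by move=> xx'; rewrite !peval_xGam; congr teval; apply/funext => u; apply: xx' (valP u).
Qed.

Lemma card_slot : #|slot d| = dsum d.
Proof.
by rewrite /slot card_tagged sumnE big_map big_enum /=; apply: eq_bigr => i _; rewrite card_ord.
Qed.

Lemma card_grp (j : 'I_k) : #|grp (@grpof k d) j| = d j.
Proof.
rewrite card_sig; pose h (r : 'I_(d j)) : slot d := Tagged (fun i => 'I_(d i)) r.
have h_inj : injective h by move=> r r' /eqP; rewrite eq_Tagged => /eqP.
rewrite -[RHS]card_ord -(card_image h_inj).
apply: eq_card => -[i r]; rewrite inE /grpof /=; apply/eqP/mapP => [ij|[r' _ []] //].
by subst i; exists r; rewrite ?mem_enum.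
Qed.

Lemma mem_hspace (Gam : factors R d) (T : forall j, tensor R (grp (@grpof k d) j)) :
  (forall j, T j \in symtensor R (grp (@grpof k d) j)) ->
  \sum_j ins (T j) (Gam j) \in hspace Gam.
Proof.
move=> Ts; rewrite /hspace; apply: memv_sumr => j _.
pose h (T : tensor R (grp (@grpof k d) j)) := ins T (Gam j).
have hl : linear h.
  by move=> a U V; apply/ffunP => f; rewrite !ffunE /= mulrDl -scalerAl.
pose hm := GRing.isLinear.Build _ _ _ _ h hl.
pose hL : {linear _ -> _} := HB.pack h hm.
by have := memv_img (linfun hL) (Ts j); rewrite lfunE.
Qed.

End Pairing.

(** * Symmetry of the tensors Gamma_j *)

Local Open Scope classical_set_scope.
Local Open Scope ring_scope.

Section CardTensors.
Variables (R : realType) (S : finType).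

(** The symmetric tensor whose pairing with the vectors (1, x_u) is the m-th elementary symmetric
    polynomial in the x_u. *)
Definition card_tensor (m : nat) : tensor R S :=
  [ffun f : {ffun S -> 'I_2} => (#|[pred u | f u != ord0]| == m)%:R].

Lemma card_tensor_perm m (g : {perm S}) (f : {ffun S -> 'I_2}) :
  card_tensor m [ffun u => f (g u)] = card_tensor m f.
Proof.
rewrite !ffunE; congr ((_ == _)%:R).
rewrite -!sum1_card [RHS](reindex_inj (@perm_inj _ g)) /=.
by apply: eq_bigl => u; rewrite !inE ffunE.
Qed.

Lemma teval_card_tensor0 (x : S -> R) : teval (card_tensor 0) x = 1.
Proof.
rewrite /teval (bigD1 [ffun=> ord0]) //= [X in _ + X]big1 => [|f f0].
  rewrite addr0 big1 ?mulr1 => [|u _]; last by rewrite ffunE eqxx.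
  by rewrite ffunE eq_card0 // => u; rewrite !inE ffunE eqxx.
rewrite ffunE; case: eqP => [/card0_eq f0'|]; last by rewrite mul0r.
move/eqP: f0; case; apply/ffunP => u; rewrite ffunE; apply/eqP/negPn.
by have := f0' u; rewrite !inE => ->.
Qed.

Lemma exists_card m : (m <= #|S|)%N ->
  exists f : {ffun S -> 'I_2}, #|[pred u | f u != ord0]| = m.
Proof.
move=> mS; exists [ffun u => if (enum_rank u < m)%N then ord_max else ord0].
rewrite -[RHS]card_ord.
have h_inj : injective (fun i : 'I_m => enum_val (widen_ord mS i) : S).
  by move=> i j /enum_val_inj /(congr1 val) /= ij; apply: val_inj.
rewrite -(card_image h_inj); apply: eq_card => u; rewrite inE ffunE.
case: ltnP => um /=; [apply/esym/mapP | apply/esym/negbTE/negP => /mapP].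
  exists (Ordinal um); rewrite ?mem_enum //.
  by apply: enum_rank_inj; rewrite enum_valK; apply: val_inj.
by case=> i _ ui; move: um; rewrite ui enum_valK leqNgt /= ltn_ord.
Qed.

End CardTensors.

Section Symmetry.
Variables (R : realType) (k : nat) (d : 'I_k -> nat).

(** A combination of elementary symmetric polynomials in the variables of group j. The constant term
    [a] is kept apart because it will be adjusted to prescribe the value at a given point. *)
Definition combo_tensor (j : 'I_k) (a : R) (w : 'I_(d j) -> R) :
    tensor R (grp (@grpof k d) j) :=
  a *: card_tensor R _ 0 + \sum_(r < d j) w r *: card_tensor R _ r.+1.

Lemma combo_tensor_sym j a w : @combo_tensor j a w \in symtensor R _.
Proof.
have h m : card_tensor R (grp (@grpof k d) j) m \in symtensor R _.
  by apply: mem_symtensor => g f; exact: card_tensor_perm.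
by rewrite rpredD ?rpredZ // rpred_sum // => r _; rewrite rpredZ.
Qed.

Lemma combo_tensor_perm j a w (g : {perm grp (@grpof k d) j})
    (f : {ffun grp (@grpof k d) j -> 'I_2}) :
  combo_tensor a w [ffun u => f (g u)] = combo_tensor a w f.
Proof.
rewrite /combo_tensor !ffunE /=; congr (_ * _ + _).
  by have := card_tensor_perm R 0 g f; rewrite !ffunE.
rewrite !sum_ffunE; apply: eq_bigr => r _; rewrite !ffunE; congr (_ * _).
by have := card_tensor_perm R r.+1 g f; rewrite !ffunE.
Qed.

Lemma teval_combo_tensor j a w (x : grp (@grpof k d) j -> R) :
  teval (combo_tensor a w) x =
    a + \sum_(r < d j) w r * teval (card_tensor R (grp (@grpof k d) j) r.+1) x.
Proof.
rewrite teval_linear teval_card_tensor0 mulr1 teval_sum; congr (_ + _).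
apply: eq_bigr => r _; rewrite -[_ *: _]addr0 teval_linear teval0 addr0.
by [].
Qed.

(** The tensors [card_tensor m] have disjoint supports, so each coefficient can be read at an index
    function with r + 1 non-zero entries. *)
Lemma combo_tensor_eq0 j a w : @combo_tensor j a w = 0 -> forall r, w r = 0.
Proof.
move=> c0 r.
have [f fr] : exists f : {ffun grp (@grpof k d) j -> 'I_2},
    #|[pred u | f u != ord0]| = r.+1 by apply: exists_card; rewrite card_grp.
have := congr1 (fun T : tensor R _ => T f) c0.
rewrite /combo_tensor !ffunE fr scaler0 add0r sum_ffunE (bigD1 r) //= !ffunE fr eqxx.
rewrite big1 => [|r' r'r]; first by rewrite addr0 /GRing.scale /= mulr1.
rewrite !ffunE fr eqSS (_ : (_ == _) = false) ?scaler0 //.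
by apply/negbTE; rewrite eq_sym; exact: r'r.
Qed.

End Symmetry.

Local Open Scope classical_set_scope.
Local Open Scope ring_scope.

Section Swap.
Variables (R : realType) (k : nat) (d : 'I_k -> nat) (Gam : factors R d).
Implicit Types (x c : slot d -> R) (s t : slot d) (j : 'I_k).

Notation G j x := (peval (xGam Gam j) x).

Lemma teval_grp_swap s t (T : tensor R (grp (@grpof k d) (grpof s))) x :
  (forall (g : {perm grp (@grpof k d) (grpof s)})
     (f : {ffun grp (@grpof k d) (grpof s) -> 'I_2}), T [ffun u => f (g u)] = T f) ->
  grpof t = grpof s ->
  teval T (fun u => x (tperm s t (val u))) = teval T (fun u => x (val u)).
Proof.
move=> Tsym ts.
pose s' : grp (@grpof k d) (grpof s) := exist _ s (eqxx _).
have tsb : grpof t == grpof s by rewrite ts.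
pose t' : grp (@grpof k d) (grpof s) := exist _ t tsb.
rewrite -(teval_perm _ (Tsym (tperm s' t'))); congr teval; apply/funext => u /=.
congr (x _); case: (tpermP s' t' u) => [->|->|us ut] /=; rewrite ?tpermL ?tpermR //.
by rewrite tpermD //; apply/eqP => e; [apply: us | apply: ut]; apply: val_inj.
Qed.

(* If some swap moved some [G_j], then [dsum + 2] elements of [h] would be
   independent: for each group [j], [d j] elements [f_j G_j] with [f_j]
   vanishing at a generic point [c], and two multiples of a [G_j] that the swap
   moves and of one that it fixes.  Applying [1 - swap] and then letting a
   single group of variables leave [c] isolates the coefficients. *)
Lemma xGam_swap (s t : slot d) : segre_veronese Gam -> grpof t = grpof s ->
  forall j x, G j (x \o tperm s t) = G j x.
Proof.
move=> [_ _ Gam0 dimh _] ts.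
pose D j x := G j (x \o tperm s t) - G j x.
suff D0 j x : D j x = 0 by move=> j x; apply/subr0_eq/D0.
apply/eqP/negPn/negP => Djx.
pose moved i := `[< exists y, D i y != 0 >].
have mj : moved j by apply/asboolP; exists x.
pose p := grpof s.
(* For i different from p both swapped slots lie outside group i, hence D i does not see the
   variables of group i. *)
have D_ext i y y' : i != p -> (forall u, grpof u != i -> y u = y' u) -> D i y = D i y'.
  move=> ip yy'; rewrite /D; congr (_ - _); apply: eq_peval_xGam => // u ui /=.
  apply: yy'; case: tpermP => // _; by rewrite ?ts eq_sym.
have Dp y : D p y = 0.
  apply/eqP; rewrite subr_eq0; apply/eqP; apply: eq_peval_xGam => u up /=.
  by rewrite tpermD //; apply: contraNneq up => <-; rewrite ?ts.
have jp : j != p by apply: contraNneq Djx => ->; rewrite Dp.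
have swap_lp i : line_polynomial (fun y => G i (y \o tperm s t)).
  move=> y z; have [u uE] := peval_line_polynomial (xGam Gam i) (y \o tperm s t) (z \o tperm s t).
  by exists u => r; rewrite -uE.
(* The point c has to avoid the zeros of every G_i and of D i for every moved i; the constant 1
   fills in for the other i. *)
pose F (bi : bool * 'I_k) : (slot d -> R) -> R :=
  if bi.1 then fun y => G bi.2 y else if moved bi.2 then D bi.2 else fun=> 1.
have [c _ cF] : exists2 c, True & forall bi, F bi c != 0.
  apply: (@line_polynomial_common_neq0 R _ _ F (fun=> True)) => //.
  - case=> -[] i; rewrite /F /=; first exact: peval_line_polynomial.
    case: ifP => _ y z; last by exists 1 => r; rewrite hornerC.
    have [u uE] := swap_lp i y z; have [v vE] := peval_line_polynomial (xGam Gam i) y z.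
    by exists (u - v) => r; rewrite /D uE vE hornerD hornerN.
  - case=> -[] i; rewrite /F /=.
      apply: contrapT => nG; move/eqP: (Gam0 i); apply; apply: teval_eq0 => y.
      apply/eqP/negPn/negP => ty; apply: nG.
      exists (fun u => if insub u is Some v then y v else 0) => //.
      rewrite peval_xGam (_ : (fun _ => _) = y) //; apply/funext => v.
      by rewrite valK.
    rewrite /moved; case: asboolP => [[y Dy]|_]; last by exists (fun=> 0) => //; exact: oner_neq0.
    by exists y.
have cG i : G i c != 0 by exact: cF (true, i).
have cD i : moved i -> D i c != 0 by move=> mi; have := cF (false, i); rewrite /F /= mi.
(* One coordinate per slot and two more: m + 2 in all, one above dim h. [None] carries the multiple
   of the moved G_j, and [Some None] that of G_p, which has no p-slot and is fixed by the swap. *)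
pose W := {ffun option (option (slot d)) -> R^o}.
pose co i (w : W) (r : 'I_(d i)) : R := w (Some (Some (Tagged (fun i => 'I_(d i)) r))).
pose eps i (r : 'I_(d i)) : R :=
  teval (card_tensor R (grp (@grpof k d) i) r.+1) (fun u => c (val u)).
(* Chosen so that at c the factor of G_i takes the value [w None] for i = j, [w (Some None)] for i =
   p, and 0 for all other i. *)
pose a0 i (w : W) : R := (i == j)%:R * w None + (i == p)%:R * w (Some None)
   - \sum_(r < d i) co i w r * eps i r.
pose T i (w : W) := combo_tensor (a0 i w) (co i w).
pose Phi (w : W) : tensor R (slot d) := \sum_i ins (T i w) (Gam i).
have Tlin i a (u v : W) : T i (a *: u + v) = a *: T i u + T i v.
  have coE r : co i (a *: u + v) r = a * co i u r + co i v r by rewrite /co !ffunE.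
  have a0E : a0 i (a *: u + v) = a * a0 i u + a0 i v.
    rewrite /a0 !ffunE (eq_bigr (fun r => a * (co i u r * eps i r) + co i v r * eps i r)).
      by rewrite big_split /= -mulr_sumr /GRing.scale /=; ring.
    by move=> r _; rewrite coE; ring.
  rewrite /T /combo_tensor a0E scalerDl -scalerA scalerDr -!addrA; congr (_ + _).
  rewrite addrCA; congr (_ + _); rewrite scaler_sumr -big_split /=.
  by apply: eq_bigr => r _; rewrite coE scalerDl scalerA.
have Philin : linear Phi.
  move=> a u v; rewrite /Phi scaler_sumr -big_split /=; apply: eq_bigr => i _.
  apply/ffunP => f; rewrite Tlin !ffunE /GRing.scale /=; ring.
pose PhiM := GRing.isLinear.Build _ _ _ _ Phi Philin.
pose PhiL : {linear W -> tensor R (slot d)} := HB.pack Phi PhiM.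
(* An injective Phi would embed a space of dimension m + 2 into h. *)
suff Phi0 w : Phi w = 0 -> w = 0.
  have kerPhi : (lker (linfun PhiL) == 0)%VS.
    apply/eqP; apply/vspaceP => w; rewrite memv_ker memv0 lfunE /=.
    apply/eqP/eqP => [/Phi0 //|->]; exact: (linear0 PhiL).
  have : (\dim (limg (linfun PhiL)) <= \dim (hspace Gam))%N.
    apply: dimvS; apply/subvP => _ /memv_imgP[w _ ->]; rewrite lfunE /=.
    by apply: mem_hspace => i; exact: combo_tensor_sym.
  rewrite limg_dim_eq; last by rewrite (eqP kerPhi) capv0.
  rewrite dimh dimvf /dim /= muln1 !card_option card_slot; lia.
move=> Pw0.
pose tau i y : R := teval (T i w) (fun u => y (val u)).
have tauc i : tau i c = (i == j)%:R * w None + (i == p)%:R * w (Some None).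
  by rewrite /tau teval_combo_tensor /a0 subrK.
have tau_ext i y y' : (forall u, grpof u == i -> y u = y' u) -> tau i y = tau i y'.
  by move=> yy'; congr teval; apply/funext => u; apply: yy' (valP u).
have tau_swap i y : tau i (y \o tperm s t) = tau i y.
  have [->|ip] := eqVneq i p.
    apply: teval_grp_swap => // g f; exact: combo_tensor_perm.
  apply: tau_ext => u /eqP ui /=; rewrite tpermD //.
    by apply: contraNneq ip => su; rewrite -ui -su.
  by apply: contraNneq ip => su; rewrite -ui -su ts.
have sum0 y : \sum_i tau i y * G i y = 0.
  have := congr1 (fun V : tensor R (slot d) => teval V y) Pw0.
  rewrite /Phi teval_sum teval0 => h; rewrite -[RHS]h; apply: eq_bigr => i _.
  by rewrite teval_ins peval_xGam.
(* The relation at the swapped point minus the relation itself. The factors tau i are invariant,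
   being symmetric in the p-variables or free of them, so only the differences D i remain. *)
have sumD y : \sum_i tau i y * D i y = 0.
  rewrite (eq_bigr (fun i => tau i (y \o tperm s t) * G i (y \o tperm s t) - tau i y * G i y)).
    by rewrite sumrB !sum0 subrr.
  by move=> i _; rewrite tau_swap mulrBr.
have w1 : w None = 0.
  have := sumD c; rewrite (bigD1 j) //= big1 => [|i ij].
    rewrite addr0 tauc eqxx (negbTE jp) mul0r addr0 mul1r => /eqP.
    by rewrite mulf_eq0 (negbTE (cD _ mj)) orbF => /eqP.
  have [->|ip] := eqVneq i p; first by rewrite Dp mulr0.
  by rewrite tauc (negbTE ij) (negbTE ip) !mul0r addr0 mul0r.
(* Only the variables of group i leave c. G_i does not see them and keeps its value at c; each other
   tau i' depends on group i' alone and keeps its value too. *)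
pose mix i y : slot d -> R := fun u => if grpof u == i then y u else c u.
have mix_tau i y i' : i' != i -> tau i' (mix i y) = tau i' c.
  by move=> ii'; apply: tau_ext => u /eqP ui'; rewrite /mix ui' (negbTE ii').
have mix_tau_id i y : tau i (mix i y) = tau i y.
  by apply: tau_ext => u ui; rewrite /mix ui.
have tau_moved i : moved i -> forall y, tau i y = 0.
  move=> mi y; have ip : i != p by apply: contraNneq (cD _ mi) => ->; rewrite Dp.
  have := sumD (mix i y); rewrite (bigD1 i) //= big1 => [|i' ii'].
    rewrite addr0 mix_tau_id (D_ext _ _ c) // => [/eqP|u ui].
      by rewrite mulf_eq0 (negbTE (cD _ mi)) orbF => /eqP.
    by rewrite /mix (negbTE ui).
  have [->|i'p] := eqVneq i' p; first by rewrite Dp mulr0.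
  by rewrite mix_tau // tauc w1 (negbTE i'p) mul0r mulr0 addr0 mul0r.
have w2 : w (Some None) = 0.
  have := sum0 c; rewrite (bigD1 p) //= big1 => [|i ip].
    rewrite addr0 tauc eqxx w1 mulr0 add0r mul1r => /eqP.
    by rewrite mulf_eq0 (negbTE (cG _)) orbF => /eqP.
  by rewrite tauc w1 (negbTE ip) mul0r mulr0 addr0 mul0r.
have tauc0 i : tau i c = 0 by rewrite tauc w1 w2 !mulr0 addr0.
have tau0 i y : tau i y = 0.
  have := sum0 (mix i y); rewrite (bigD1 i) //= big1 => [|i' ii'].
    rewrite addr0 mix_tau_id (@eq_peval_xGam _ _ _ _ _ _ c) => [/eqP|u ui].
      by rewrite mulf_eq0 (negbTE (cG _)) orbF => /eqP.
    by rewrite /mix (negbTE ui).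
  by rewrite mix_tau // tauc0 mul0r.
have T0 i : T i w = 0.
  apply: teval_eq0 => y.
  rewrite -(tau0 i (fun u => if insub u is Some v then y v else 0)) /tau.
  by congr teval; apply/funext => v; rewrite valK.
apply/ffunP => -[[[i r]|]|]; rewrite ffunE ?w1 ?w2 //.
exact: combo_tensor_eq0 (T0 i) r.
Qed.

End Swap.

Local Open Scope classical_set_scope.
Local Open Scope ring_scope.

(** * Fixed roots and decomposable tensors *)

Section Decomposition.
Variables (R : realType).

Lemma eq_teval_slice (S : finType) (T : tensor R S) u (y y' : S -> R) :
  (forall v, v != u -> y v = y' v) ->
  teval (slice0 u T) y = teval (slice0 u T) y' /\
  teval (slice1 u T) y = teval (slice1 u T) y'.
Proof.
move=> yy'; suff h (V : tensor R S) : (forall f : {ffun S -> 'I_2}, f u != ord0 -> V f = 0) ->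
    teval V y = teval V y'.
  by split; apply: h => f /negbTE fu; rewrite ffunE fu.
move=> V0; apply: eq_bigr => f _; have [fu|/V0 ->] := eqVneq (f u) ord0; last by rewrite !mul0r.
congr (_ * _); apply: eq_bigr => v _; case: ifP => // fv; apply: yy'.
by apply: contraFneq fv => ->; rewrite fu eqxx.
Qed.

(** On the hyperplane x_u = r the pairing is that of [slice0 + r slice1], so this tensor is zero.
    The conclusion is divisibility by x_u - r, written in coordinates. *)
Lemma slice_root (S : finType) (T : tensor R S) u (r : R) :
  (forall y, y u = r -> teval T y = 0) ->
  forall f : {ffun S -> 'I_2}, f u = ord0 -> T f = - r * T (fset1 u ord_max f).
Proof.
move=> Tr; have s0 : r *: slice1 u T + slice0 u T = 0.
  apply: teval_eq0 => y; rewrite teval_linear.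
  have [-> ->] := @eq_teval_slice S T u y (fun v => if v == u then r else y v)
    (fun v vu => esym (ifN_eq _ _ vu)).
  have := Tr (fun v => if v == u then r else y v); rewrite eqxx => /(_ erefl).
  by rewrite (teval_split _ u) eqxx addrC.
move=> f fu; have := congr1 (fun V : tensor R S => V f : R) s0.
rewrite !ffunE fu eqxx /GRing.scale /= => /eqP; rewrite addrC addr_eq0 => /eqP ->.
by rewrite mulNr.
Qed.

(** [slice_root] applied to one slot of [l] after another. The factors - r and 1 are the coordinates
    of the form x_u - r, and the cofactor is read off where all indices in [l] are [ord_max]. *)
Lemma slice_root_prod (S : finType) (T : tensor R S) (l : seq S) (r : R) :
  uniq l -> (forall u y, u \in l -> y u = r -> teval T y = 0) ->
  forall f : {ffun S -> 'I_2},
  T f = \prod_(u <- l) (if f u == ord0 then - r else 1) *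
        T [ffun u => if u \in l then ord_max else f u].
Proof.
elim: l => [_ _ f|a l IH /= /andP[al ul] Tr f].
  by rewrite big_nil mul1r; congr (T _); apply/ffunP => u; rewrite ffunE.
rewrite big_cons (IH ul) => [|u y ul']; last by apply: Tr; rewrite inE ul' orbT.
rewrite [X in _ = X * _]mulrC -!mulrA; congr (_ * _).
set g := [ffun u => if u \in l then _ else _].
have ga : g a = f a by rewrite ffunE (negbTE al).
rewrite [in RHS](_ : [ffun _ => _] = fset1 a ord_max g); last first.
  by apply/ffunP => u; rewrite !ffunE inE; case: eqP.
case: eqP => [fa|/eqP /ord2_neq0 fa].
  by apply: slice_root; [move=> y; apply: Tr; rewrite mem_head | rewrite ga].
rewrite mul1r; congr (T _); apply/ffunP => u; rewrite [RHS]ffunE.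
by case: eqP => // ->; rewrite ga.
Qed.

Lemma teval_tpow (S : finType) (e : 'rV[R]_2) (y : S -> R) :
  teval (tpow S e) y = \prod_u (e ord0 ord0 + y u * e ord0 ord_max).
Proof.
rewrite (eq_bigr (fun u => \sum_(i < 2) e ord0 i * (if i == ord0 then 1 else y u))).
  rewrite bigA_distr_bigA; apply: eq_bigr => f _; rewrite ffunE -big_split.
  by apply: eq_bigr.
move=> u _; rewrite big_ord_recl big_ord1 /= mulr1 [y u * _]mulrC; congr (_ + e _ _ * _).
exact: val_inj.
Qed.

Lemma deriv_eq0 (p : {poly R}) : p^`() = 0 -> p = (p`_0)%:P.
Proof.
move=> p0; apply/polyP => -[|i]; rewrite coefC //=.
have := congr1 (fun q : {poly R} => q`_i) p0; rewrite coef_deriv coef0 => /eqP.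
by rewrite mulrn_eq0 /= => /eqP.
Qed.

Variables (k : nat) (d : 'I_k -> nat) (Gam : factors R d).
Implicit Types (x y : slot d -> R) (s t : slot d) (j : 'I_k).
Notation G j x := (peval (xGam Gam j) x).

(** By [xGam_swap], a root r in x_s that does not depend on the other variables is also a root in
    x_t for each p-slot t. The form x - r, that is e = (- r, 1), therefore splits off at all p-slots
    together. *)
Lemma decomposes_of_root s j (r : R) : segre_veronese Gam -> j != grpof s ->
  (forall x, x s = r -> G j x = 0) -> exists e, decomposes_with Gam (grpof s) j e.
Proof.
move=> hGam js Gr; set p := grpof s in js *.
exists (\row_i (if i == ord0 then - r else 1)).
pose lab (u : rest (@grpof k d) j) := grpof (val u).
pose l := [seq u <- index_enum (rest (@grpof k d) j) | lab u == p].
have Tr u (y : rest (@grpof k d) j -> R) : u \in l -> y u = r -> teval (Gam j) y = 0.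
  rewrite mem_filter => /andP[/eqP up _] yu.
  pose x v : R := if insub v is Some w then y w else 0.
  have xv : (fun w => x (val w)) = y by apply/funext => w; rewrite /x valK.
  rewrite -xv -(peval_xGam Gam) -(xGam_swap (s := s) (t := val u) hGam up) Gr //=.
  by rewrite tpermL /x valK.
(* The cofactor is Gamma_j with every p-index set to [ord_max], where e has coordinate 1. *)
exists [ffun g : {ffun rest lab p -> 'I_2} =>
  Gam j [ffun v => if insub v is Some w then g w else ord_max]].
apply/ffunP => f; rewrite !ffunE [LHS](slice_root_prod _ Tr) ?filter_uniq ?index_enum_uniq //.
congr (_ * _).
  rewrite big_filter (big_sub [pred u | lab u == p]) /=; apply: eq_bigr => u _.
  by rewrite mxE ffunE.
congr (fun_of_fin (Gam j) _); apply/ffunP => v; rewrite !ffunE mem_filter mem_index_enum andbT.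
case: insubP => [w _ <-|]; first by rewrite ffunE (negbTE (valP w)).
by rewrite negbK => ->.
Qed.

(** [pdeg] is read off monomials, whereas the choice of generic points needs a non-zero value. If
    the derivative vanished everywhere, the slice of Gamma_j along slot s would be zero as a
    function, hence as a tensor, and no monomial would contain x_s. *)
Lemma xGam_pderiv_neq0 s j : pdeg s (xGam Gam j) != 0%N ->
  exists x, peval (pderiv s (xGam Gam j)) x != 0.
Proof.
move=> Gs; apply: contrapT => nx; move/negP: Gs; apply.
have Gconst x a : G j [eta x with s |-> a] = G j x.
  have dx : (upoly s x (xGam Gam j))^`() = 0.
    rewrite -upoly_pderiv; apply: (poly_eq0_itv (@ltr01 R)) => b _.
    rewrite horner_upoly; apply/eqP/negPn/negP => h; apply: nx.
    by exists [eta x with s |-> b].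
  by rewrite -{2}(eta_with_id x s) -!horner_upoly (deriv_eq0 dx) !hornerC.
have := pdeg_xGam_le Gam s j; case: eqVneq => [_|js _]; first by rewrite leqn0.
rewrite eq_sym in js; pose u0 : rest (@grpof k d) j := exist _ s js.
have s1 : slice1 u0 (Gam j) = 0.
  apply: teval_eq0 => y; pose x v : R := if insub v is Some w then y w else 0.
  have xE a : teval (Gam j) (fun v => if v == u0 then a else y v) = G j [eta x with s |-> a].
    rewrite peval_xGam; congr teval; apply/funext => v /=.
    by rewrite -[v == u0]val_eqE /= /x valK.
  have := xE 1; rewrite Gconst -(Gconst x 0) -xE (teval_split _ u0) [RHS](teval_split _ u0).
  rewrite eqxx mul1r mul0r addr0.
  have yy a v : v != u0 -> (if v == u0 then a else y v) = y v by move=> /negbTE ->.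
  have [-> ->] := eq_teval_slice (Gam j) (yy 1); have [-> _] := eq_teval_slice (Gam j) (yy 0).
  by move=> h; apply: (addrI (teval (slice0 u0 (Gam j)) y)); rewrite addr0.
rewrite -leqn0; apply: pdeg_sum_le => f _.
have [fu|fu] := eqVneq (f u0) ord0; last first.
  have := congr1 (fun V : tensor R _ => V (fset1 u0 ord0 f)) s1; rewrite !ffunE eqxx eqxx.
  rewrite (_ : fset1 u0 ord_max _ = f) => [->|]; first by rewrite scale0r pdeg0.
  apply/ffunP => v; rewrite !ffunE; case: eqP => // ->.
  by rewrite (ord2_neq0 fu).
apply: leq_trans (pdegZ_le _ _ _) _.
apply: (@leq_trans (\sum_(v : rest (@grpof k d) j) 0)); last by rewrite big1.
apply: pdeg_prod_le => v _; case: ifP => fv; first by rewrite pdeg1.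
rewrite pdeg_var leqn0 eqb0; apply: contraFN fv => /eqP vs.
by have -> : v = u0; [exact: val_inj | rewrite fu].
Qed.

(** Slot s occurs in exactly one factor of the tensor power and not in [U], so everything else is a
    constant with respect to x_s. *)
Lemma decomposes_factor s j (e : 'rV[R]_2) y : decomposes_with Gam (grpof s) j e ->
  j != grpof s ->
  exists c, forall a, G j [eta y with s |-> a] = c * (e ord0 ord0 + a * e ord0 ord_max).
Proof.
move=> [U GE] js; rewrite eq_sym in js.
pose u0 : rest (@grpof k d) j := exist _ s js.
pose lab (u : rest (@grpof k d) j) := grpof (val u).
pose v0 : grp lab (grpof s) := exist _ u0 (eqxx _).
exists (\prod_(v : grp lab (grpof s) | v != v0) (e ord0 ord0 + y (val (val v)) * e ord0 ord_max)
   * teval U (fun v => y (val (val v)))) => a.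
rewrite peval_xGam GE teval_ins teval_tpow.
have -> : (fun v : rest lab (grpof s) => [eta y with s |-> a] (val (val v))) =
    (fun v => y (val (val v))).
  apply/funext => v /=; rewrite ifN //.
  by apply: contra (valP v) => /eqP vs; rewrite -[X in _ == grpof X]vs.
rewrite mulrAC; congr (_ * _); rewrite mulrC (bigD1 v0) //= eqxx; congr (_ * _).
by apply: eq_bigr => v vv0; rewrite ifN.
Qed.

End Decomposition.

(** * Degrees of the coefficients of the equation *)

Local Open Scope classical_set_scope.
Local Open Scope ring_scope.

Section DegreeBounds.
Variables (R : realType) (k : nat) (d : 'I_k -> nat) (Gam : factors R d).
Implicit Types (x y : slot d -> R) (s t : slot d) (j : 'I_k) (P Q B : mpoly #|slot d| R).

Lemma pderiv_pdeg0 s P : pdeg s P = 0%N -> pderiv s P = 0.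
Proof.
move=> P0; apply/mpolyP => m; rewrite /pderiv mcoeff_deriv mcoeff0.
suff -> : mcoeff (mnm_add m (mnm1 (enum_rank s))) P = 0 by rewrite mul0rn.
apply: memN_msupp_eq0; apply/negP => /(pdeg_msupp s).
by rewrite P0 mnmDE mnm1E eqxx addn1.
Qed.

Lemma pderivM s P Q : pderiv s (P * Q) = pderiv s P * Q + P * pderiv s Q.
Proof. exact: mderivM. Qed.

(** The product in (E) runs over all groups, the one in [coefs] omits the group of the
    differentiated slot. The omitted power is constant in that variable and can be taken out. *)
Lemma leibniz_coefs_mul s B C P n : pderiv s C = 0 ->
  (leibniz_coefs s B (C * P))`_n = C * (leibniz_coefs s B P)`_n.
Proof.
move=> C0; rewrite /leibniz_coefs !(pderivM, C0, mul0r, add0r).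
case: n => [|[|[|n]]] /=; rewrite ?nth_nil ?mulr0 //; ring.
Qed.

(** Every term is quadratic in B and its derivatives, linear in P and its derivatives, and
    derivation in x_t does not raise the x_s-degree. *)
Lemma pdeg_leibniz_le s t B P n c : (pdeg s B <= 1)%N -> (pdeg s P <= n)%N ->
  c \in leibniz_coefs t B P -> (pdeg s c <= n + 2)%N.
Proof.
move=> B1 Pn.
have B'1 : (pdeg s (pderiv t B) <= 1)%N by apply: leq_trans (pdeg_pderiv_le _ _ _) B1.
have B''1 : (pdeg s (pderiv t (pderiv t B)) <= 1)%N.
  by apply: leq_trans (pdeg_pderiv_le _ _ _) B'1.
have P'n : (pdeg s (pderiv t P) <= n)%N by apply: leq_trans (pdeg_pderiv_le _ _ _) Pn.
have P''n : (pdeg s (pderiv t (pderiv t P)) <= n)%N.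
  by apply: leq_trans (pdeg_pderiv_le _ _ _) P'n.
have nat0 (i : nat) : (pdeg s (i%:R : mpoly #|slot d| R) <= 0)%N by rewrite pdeg_nat.
have X2 (Q : mpoly #|slot d| R) : (pdeg s Q <= 1)%N -> (pdeg s (Q ^+ 2)%R <= 2)%N.
  by move=> h; have := @pdegX_le _ _ _ s Q 2 1 h.
have two : (pdeg s (2%R : mpoly #|slot d| R) <= 0)%N by have := nat0 2%N.
have M (Q1 Q2 : mpoly #|slot d| R) a b e : (pdeg s Q1 <= a)%N -> (pdeg s Q2 <= b)%N ->
    (a + b = e)%N -> (pdeg s (Q1 * Q2)%R <= e)%N.
  by move=> h1 h2 <-; exact: pdegM_le.
rewrite !inE => /or3P[]/eqP->.
- apply: pdegD_le; first apply: pdegB_le; first apply: pdegB_le.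
  + by apply: (M _ _ 2 n) => //; [exact: X2 | lia].
  + apply: (M _ _ 2 n) => //; last by lia.
    apply: (M _ _ 1 1)%N => //; apply: (M _ _ 0 1)%N => //.
    by apply: (M _ _ 0 0)%N.
  + apply: (M _ _ 2 n) => //; last by lia.
    by apply: (M _ _ 1 1)%N => //; apply: (M _ _ 0 1)%N.
  + apply: (M _ _ 2 n) => //; last by lia.
    by apply: (M _ _ 0 2)%N => //; [apply: (M _ _ 0 0)%N | exact: X2].
- apply: (M _ _ 0 (n + 2))%N => //; apply: pdegB_le.
    by apply: (M _ _ 2 n) => //; [exact: X2 | lia].
  apply: (M _ _ 2 n) => //; last by lia.
  by apply: (M _ _ 1 1)%N => //; apply: (M _ _ 0 1)%N.
- by apply: (M _ _ 2 n) => //; [exact: X2 | lia].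
Qed.

Lemma pdeg_sub_var_le s t u : (pdeg s (var R t - var R u)%R <= (t == s) + (u == s))%N.
Proof. by apply: pdegB_le; rewrite pdeg_var ?leq_addl ?leq_addr. Qed.

Lemma pdeg_Delta_self s : (pdeg s (Delta R s) < d (grpof s))%N.
Proof.
rewrite -(card_grp d (grpof s)) card_sig (cardD1 s) inE eqxx add1n ltnS.
apply: (@leq_trans (\sum_(t | (grpof t == grpof s) && (t != s)) 1)%N); last first.
  by rewrite sum1_card; apply: eq_leq; apply: eq_card => t; rewrite !inE andbC.
apply: pdeg_prod_le => t /andP[_ ts].
by apply: leq_trans (pdeg_sub_var_le _ _ _) _; rewrite eqxx (negbTE ts).
Qed.

Lemma pdeg_Delta_le s t : t != s -> (pdeg s (Delta R t) <= (grpof t == grpof s))%N.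
Proof.
move=> ts; apply: (@leq_trans (\sum_(u | (grpof u == grpof t) && (u != t)) (u == s))%N).
  apply: pdeg_prod_le => u _; apply: leq_trans (pdeg_sub_var_le _ _ _) _.
  by rewrite (negbTE ts).
rewrite eq_sym; case: eqP => [st|st].
  rewrite (bigD1 s) /=; last by rewrite st eqxx eq_sym.
  by rewrite eqxx big1 // => u /andP[_ /negbTE ->].
rewrite big1 // => u /andP[/eqP ut _]; case: eqP => // us; case: st.
by rewrite -us.
Qed.

Lemma peval_Delta x t :
  peval (Delta R t) x = \prod_(u | (grpof u == grpof t) && (u != t)) (x t - x u).
Proof.
rewrite /peval /Delta rmorph_prod; apply: eq_bigr => u _.
by rewrite rmorphB /= /var !mevalXU !enum_rankK.
Qed.

(** If x_s did not occur, replacing it by x_t would preserve the value, yet it kills the factor x_t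
    - x_s. The exact degree matters because [ell] subtracts it. *)
Lemma pdeg_Delta_eq1 s t x : t != s -> grpof t = grpof s -> peval (Delta R t) x != 0 ->
  pdeg s (Delta R t) = 1%N.
Proof.
move=> ts gts; have := pdeg_Delta_le ts; rewrite gts eqxx.
case: (posnP (pdeg s (Delta R t))) => [D0|]; last by move=> *; lia.
rewrite -(eta_with_id x s) -horner_upoly (upoly_pdeg0 _ (x t) D0) hornerC peval_Delta.
rewrite (bigD1 s) /= ?gts ?eqxx ?(eq_sym s) ?ts //.
by rewrite (negbTE ts) subrr mul0r eqxx.
Qed.

Variable beta : tensor R (slot d).
Hypothesis d_gt0 : forall j, (1 <= d j)%N.

Lemma dsum_rem j : dsum d = (d j + \sum_(b | b != j) d b)%N.
Proof. by rewrite /dsum (bigD1 j). Qed.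

Lemma pdeg_prod_xGam_le s (A : pred 'I_k) :
  (pdeg s (\prod_(b | A b) xGam Gam b ^+ d b)%R <= \sum_(b | A b) d b * (b != grpof s))%N.
Proof.
apply: pdeg_prod_le => b _; apply: pdegX_le; exact: pdeg_xGam_le.
Qed.

(** Let p and i be the groups of s and t. For i = p the count is (d_p - 1) + (m - d_p) + 2 = m + 1,
    and Delta_t has degree 1. Otherwise it is (d_p - 1) + (d_i - 1) + (m - d_i - d_p) + 2 = m. *)
Lemma pdeg_coefs_le s t c x : t != s -> peval (Delta R t) x != 0 ->
  c \in coefs Gam beta s t -> (pdeg s c <= dsum d + pdeg s (Delta R t))%N.
Proof.
move=> ts Dt /mapP[c0 c0l ->]; set i := grpof t; set p := grpof s.
have c0_le := pdeg_leibniz_le (pdeg_mu_le beta s)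
  (pdeg_prod_xGam_le s (fun b => b != grpof t)) c0l.
rewrite -/i -/p in c0_le.
have Gi := @pdegX_le _ _ _ s _ (d i).-1 _ (pdeg_xGam_le Gam s i); rewrite -/p in Gi.
have Ds := pdeg_Delta_self s; rewrite -/p in Ds.
apply: leq_trans (pdegM_le (pdegM_le (leqnn _) Gi) c0_le) _.
have [ip|ip] := eqVneq i p.
  rewrite (pdeg_Delta_eq1 ts ip Dt) muln0 addn0 (dsum_rem p) -ip.
  rewrite (eq_bigr d) => [|b bi]; last by rewrite bi muln1.
  rewrite ip; move: (\sum_(b | b != p) d b)%N => S; lia.
have pi : p != i by rewrite eq_sym.
rewrite (dsum_rem i) (bigD1 p) //= [in X in (_ <= X)%N](bigD1 p) //=.
rewrite eqxx muln0 muln1 (eq_bigr d) => [|b /andP[_ bp]]; last by rewrite bp muln1.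
move: (\sum_(b < k | _) d b)%N (d_gt0 i) => S di; lia.
Qed.

Lemma pdeg_rhs_le s a : (pdeg s (rhs Gam s a) <= dsum d)%N.
Proof.
have Ds := pdeg_Delta_self s.
apply: leq_trans (pdegM_le (pdegM_le (pdeg_mu_le a s) (leqnn _))
  (pdeg_prod_xGam_le s predT)) _.
rewrite (dsum_rem (grpof s)) (bigD1 (grpof s)) //= eqxx muln0 add0n.
rewrite (eq_bigr d) => [|b bi]; last by rewrite bi muln1.
lia.
Qed.

Lemma ell_le_dsum s x : (forall t, peval (Delta R t) x != 0) ->
  (ell Gam beta s <= dsum d)%N.
Proof.
move=> Dx; rewrite geq_max; apply/andP; split; last first.
  by apply/bigmax_leqP_seq => a _ _; exact: pdeg_rhs_le.
apply/bigmax_leqP => t ts; apply/bigmax_leqP_seq => c cl _.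
by rewrite leq_subLR addnC (pdeg_coefs_le ts (Dx t)).
Qed.

Lemma pdeg_coefs_ell s t c : t != s -> c \in coefs Gam beta s t ->
  (pdeg s c <= ell Gam beta s + pdeg s (Delta R t))%N.
Proof.
move=> ts cl; rewrite addnC -leq_subLR; apply: leq_trans (leq_maxl _ _).
apply: (@leq_trans (\max_(c <- coefs Gam beta s t) (pdeg s c - pdeg s (Delta R t))%N)).
  exact: (@leq_bigmax_seq _ _ xpredT (fun c => pdeg s c - pdeg s (Delta R t))%N).
exact: (@leq_bigmax_cond _ (fun t => t != s) (fun t => \max_(c <- coefs Gam beta s t)
  (pdeg s c - pdeg s (Delta R t))%N)%N).
Qed.

Lemma mu_sum (J : Type) (r : seq J) (c : J -> R) (a : J -> tensor R (slot d)) :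
  mu (\sum_(i <- r) c i *: a i) = \sum_(i <- r) c i *: mu (a i).
Proof.
have muD c0 a0 b0 : mu (c0 *: a0 + b0) = c0 *: mu a0 + mu b0 :> mpoly #|slot d| R.
  rewrite /mu /pairing scaler_sumr -big_split /=; apply: eq_bigr => f _.
  by rewrite !ffunE scalerDl scalerA.
elim: r => [|i r IH]; last by rewrite !big_cons muD IH.
by rewrite !big_nil /mu /pairing big1 // => f _; rewrite ffunE scale0r.
Qed.

(** [ell] tests a basis of h only; [rhs] is linear in a, so the bound extends to all of h. *)
Lemma pdeg_rhs_ell s a : a \in hspace Gam ->
  (pdeg s (rhs Gam s a) <= ell Gam beta s)%N.
Proof.
move=> /coord_vbasis ->; apply: leq_trans (leq_maxr _ _).
rewrite /rhs mu_sum !mulr_suml; apply: pdeg_sum_le => i _.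
rewrite -!scalerAl; apply: leq_trans (pdegZ_le _ _ _) _.
rewrite -/(rhs Gam s _).
apply: (@leq_bigmax_seq _ _ xpredT (fun a => pdeg s (rhs Gam s a))) => //.
by rewrite mem_nth // size_tuple.
Qed.

End DegreeBounds.

Local Open Scope classical_set_scope.
Local Open Scope ring_scope.

(** * The equation without denominators, restricted to one variable *)

Section ClearedEquation.
Local Open Scope classical_set_scope.
Local Open Scope ring_scope.
Variables (R : realType) (k : nat) (d : 'I_k -> nat) (Gam : factors R d).
Variable beta : tensor R (slot d).
Hypothesis d_gt0 : forall j, (1 <= d j)%N.
Implicit Types (x y z : slot d -> R) (s t : slot d) (P Q B : mpoly #|slot d| R).

Lemma pevalM P Q x : peval (P * Q) x = peval P x * peval Q x.
Proof. exact: mevalM. Qed.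

Lemma pevalX P n x : peval (P ^+ n) x = peval P x ^+ n.
Proof. exact: rmorphXn. Qed.

Lemma peval_prod (J : Type) (r : seq J) (A : pred J) (F : J -> mpoly #|slot d| R) x :
  peval (\prod_(j <- r | A j) F j) x = \prod_(j <- r | A j) peval (F j) x.
Proof. exact: rmorph_prod. Qed.

Lemma coefs_nth s t n : (n < 3)%N -> (coefs Gam beta s t)`_n =
  Delta R s * xGam Gam (grpof t) ^+ (d (grpof t)).-1 *
    (leibniz_coefs t (mu beta) (\prod_(b | b != grpof t) xGam Gam b ^+ d b))`_n.
Proof. by move=> n3; rewrite (nth_map 0). Qed.

(** (E) multiplied by Delta_s and the product of all G_b^(d_b), with each second derivative expanded
    by [leibniz_coefsE]. The division by Delta_t is kept: it becomes exact only as a statement about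
    polynomials in x_s. *)
Lemma extremality_cleared (A : slot d -> R -> R) (alpha : tensor R (slot d)) s z :
  (forall t, peval (Delta R t) z != 0) ->
  (forall i, peval (xGam Gam i) z != 0) -> peval (mu beta) z != 0 ->
  (forall t, \forall u \near z t, derivable (A t) u 1) ->
  (forall t, derivable (derive1 (A t)) (z t) 1) ->
  extremality_equation Gam beta A alpha z ->
  \sum_t (\sum_(n < 3) peval (coefs Gam beta s t)`_n z * derive1n n (A t) (z t))
     / peval (Delta R t) z = peval (rhs Gam s alpha) z.
Proof.
move=> DN0 GN0 BN0 dA ddA E.
pose Pi := \prod_b peval (xGam Gam b) z ^+ d b.
have PiN0 : Pi != 0 by apply/prodf_neq0 => b _; rewrite expf_neq0.
have -> : peval (rhs Gam s alpha) z = peval (Delta R s) z * Pi * peval (mu alpha) z.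
  rewrite /rhs !pevalM peval_prod (eq_bigr _ (fun b _ => pevalX _ _ _)) -/Pi; ring.
rewrite -E mulr_sumr; apply: eq_bigr => t _; set i := grpof t.
pose P := \prod_(b | b != i) xGam Gam b ^+ d b.
have PE : \prod_b xGam Gam b ^+ d b = xGam Gam i ^+ d i * P by rewrite (bigD1 i).
have Gi0 : pderiv t (xGam Gam i ^+ d i) = 0.
  apply: pderiv_pdeg0; apply/eqP; rewrite -leqn0 -(muln0 (d i)).
  by apply: pdegX_le; have := pdeg_xGam_le Gam t i; rewrite eqxx.
have -> : (fun u => let y := [eta z with t |-> u] in
      A t u / peval (mu beta) y ^+ (dsum d + 1) *
      \prod_j peval (xGam Gam j) y ^+ d j) =
    (fun u => let y := [eta z with t |-> u] in
      A t u / peval (mu beta) y ^+ (dsum d + 1) *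
      peval (\prod_b xGam Gam b ^+ d b) y).
  apply/funext => u; cbv zeta; rewrite peval_prod; congr (_ * _).
  by apply: eq_bigr => b _; rewrite pevalX.
rewrite -/Pi [X in _ = _ * X]mulrAC leibniz_coefsE //.
rewrite !big_ord_recl big_ord0.
rewrite !coefs_nth //. rewrite -/i -/P. clearbody P.
rewrite PE. rewrite !(leibniz_coefs_mul (mu beta) P _ Gi0).
rewrite !pevalM. rewrite !pevalX. rewrite /=.
(* The power G_i^(d_i) taken out of the derivative meets the G_i of the denominator, which leaves
   the exponent d_i - 1 of [coefs]. *)
have -> : peval (xGam Gam i) z ^+ d i =
    peval (xGam Gam i) z * peval (xGam Gam i) z ^+ (d i).-1.
  by rewrite -exprS prednK.
field.
by rewrite PiN0 GN0 DN0.
Qed.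

Lemma upolyB s y P Q : upoly s y (P - Q) = upoly s y P - upoly s y Q.
Proof. exact: rmorphB. Qed.

Lemma upolyD s y P Q : upoly s y (P + Q) = upoly s y P + upoly s y Q.
Proof. exact: rmorphD. Qed.

Lemma upolyN s y P : upoly s y (- P) = - upoly s y P.
Proof. exact: rmorphN. Qed.

Lemma upoly_nat s y n : upoly s y n%:R = n%:R.
Proof. exact: rmorph_nat. Qed.

Lemma upoly_prod s y (J : Type) (r : seq J) (A : pred J) (F : J -> mpoly #|slot d| R) :
  upoly s y (\prod_(j <- r | A j) F j) = \prod_(j <- r | A j) upoly s y (F j).
Proof. exact: rmorph_prod. Qed.

Lemma upoly_var s y t : upoly s y (var R t) = if t == s then 'X else (y t)%:P.
Proof.
by rewrite /upoly /var mmapX mmap1U (inj_eq enum_rank_inj) enum_rankK.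
Qed.

(* [Delta t] cancels against the factor [x_s - x_t] of [Delta s]. *)
Lemma coefs_quotient s t c y : t != s -> c \in coefs Gam beta s t ->
  upoly s y (Delta R t) != 0 ->
  exists2 q : {poly R}, (size q <= (ell Gam beta s).+1)%N &
    upoly s y c = q * upoly s y (Delta R t).
Proof.
move=> ts cl DN0; have c_ell := pdeg_coefs_ell ts cl.
have Dt := pdeg_Delta_le R ts.
have sc := size_upoly_le s y c.
case: (eqVneq (grpof t) (grpof s)) Dt => [gts D1|gts D0]; last first.
  have {}D0 : pdeg s (Delta R t) = 0%N by apply/eqP; rewrite -leqn0.
  have DE := upoly_pdeg0 y 0 D0; set a := peval _ _ in DE.
  have aN0 : a != 0 by rewrite -polyC_eq0 -DE.
  exists (a^-1 *: upoly s y c).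
    apply: leq_trans (size_scale_leq _ _) _; apply: leq_trans sc _.
    by rewrite ltnS (leq_trans c_ell) // D0 addn0.
  by rewrite DE -scalerAl mulrC mul_polyC scalerA mulVf // scale1r.
have [q0 q0E] : exists q0, upoly s y (Delta R s) = ('X - (y t)%:P) * q0.
  rewrite /Delta upoly_prod (bigD1 t) /=; last by rewrite gts eqxx.
  by rewrite upolyB !upoly_var eqxx (negbTE ts); eexists.
have [a DE] : exists a, upoly s y (Delta R t) = a *: ('X - (y t)%:P).
  rewrite /Delta upoly_prod (bigD1 s) /=; last by rewrite gts eqxx eq_sym.
  rewrite upolyB !upoly_var eqxx (negbTE ts).
  exists (- \prod_(u | (grpof u == grpof t) && (u != t) && (u != s)) (y t - y u)).
  rewrite scaleNr -scalerN opprB mulrC -mul_polyC rmorph_prod; congr (_ * _).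
  apply: eq_bigr => u /andP[_ us].
  by rewrite upolyB !upoly_var (negbTE ts) (negbTE us) rmorphB.
have aN0 : a != 0 by apply: contraNneq DN0 => a0; rewrite DE a0 scale0r.
have [c' cE] : exists c', c = Delta R s * c'.
  by move/mapP: cl => [c0 _ ->]; rewrite -mulrA; eexists.
pose q1 := q0 * upoly s y c'.
have cq1 : upoly s y c = ('X - (y t)%:P) * q1 by rewrite cE upolyM q0E mulrA.
exists (a^-1 *: q1); last first.
  by rewrite DE cq1 -scalerAl -scalerAr scalerA mulVf // scale1r mulrC.
apply: leq_trans (size_scale_leq _ _) _.
have [->|q1N0] := eqVneq q1 0; first by rewrite size_poly0.
have := sc; rewrite cq1 mulrC size_Mmonic ?monicXsubC // size_XsubC addn2 /= ltnS.
by move=> /leq_trans; apply; apply: leq_trans c_ell _; rewrite -addn1 leq_add2l.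
Qed.

(** As B is affine in x_s, the term with its second derivative drops and what is left has exactly
    the coefficients of [ode_poly] for n = m + 1. *)
Lemma upoly_leibniz s y B P : (size (upoly s y B) <= 2)%N ->
  let b := upoly s y B in let p := upoly s y P in let n := (dsum d + 1)%N in
  [/\ upoly s y (leibniz_coefs s B P)`_0 =
        b ^+ 2 * p^`()^`() - 2 * n%:R * b * b^`() * p^`()
          + n%:R * (n%:R + 1) * b^`() ^+ 2 * p,
      upoly s y (leibniz_coefs s B P)`_1 = 2 * (b ^+ 2 * p^`() - n%:R * b * b^`() * p) &
      upoly s y (leibniz_coefs s B P)`_2 = b ^+ 2 * p].
Proof.
move=> sb b p n; have b''0 : b^`()^`() = 0.
  apply/polyP => i; rewrite !coef_deriv coef0 nth_default ?mul0rn //.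
  by apply: leq_trans sb _.
have n2 : (dsum d + 2)%:R = n%:R + 1 :> {poly R} by rewrite /n natr1 addn1 addn2.
have one : upoly s y 1 = 1 by exact: rmorph1.
rewrite /leibniz_coefs /= !(upolyD, upolyN, upolyM, upoly_nat, one, upoly_pderiv).
rewrite -/b -/p -/n b''0 n2; split; ring.
Qed.

(** With all variables but x_s frozen, A_t, A_t' and A_t'' are constants for t different from s.
    Their terms, which are polynomials in x_s by [coefs_quotient], move to the right-hand side and
    form Q; the term at s is the operator of [ode_poly]. *)
Lemma extremal_numerator (I : slot d -> set R) (A : slot d -> R -> R) s y :
  extremal_solution Gam beta I A -> (forall t, I t (y t)) ->
  exists M : {poly R},
    [/\ forall a, I s a ->
          A s a * (upoly s y (\prod_(b | b != grpof s) xGam Gam b ^+ d b)).[a] = M.[a],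
        (size M <= (dsum d + 2).+1)%N &
        pderiv s (mu beta) = 0 -> (size M <= (ell Gam beta s + 2).+1)%N].
Proof.
move=> [oiI smooth nz [alpha alpha_h E]] Iy; set P := \prod_(b | _) _.
have oI t : open (I t) by case: (oiI t).
have iI t : is_interval (I t) by case: (oiI t).
have I0 t : I t !=set0 by case: (oiI t).
pose z a : slot d -> R := [eta y with s |-> a].
have zs a : z a s = a by rewrite /z /= eqxx.
have zt a t : t != s -> z a t = y t by move=> /negbTE ts; rewrite /z /= ts.
have Iz a t : I s a -> I t (z a t) by move=> Ia; rewrite /z /=; case: eqP => // ->.
have DN0 a t : I s a -> peval (Delta R t) (z a) != 0.
  by move=> Ia; have [] := nz (z a) (fun t => Iz a t Ia).
have GN0 a j : I s a -> peval (xGam Gam j) (z a) != 0.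
  by move=> Ia; have [] := nz (z a) (fun t => Iz a t Ia).
have BN0 a : I s a -> peval (mu beta) (z a) != 0.
  by move=> Ia; have [] := nz (z a) (fun t => Iz a t Ia).
have eqn a : I s a ->
  \sum_t (\sum_(n < 3) peval (coefs Gam beta s t)`_n (z a) * derive1n n (A t) (z a t))
     / peval (Delta R t) (z a) = peval (rhs Gam s alpha) (z a).
  move=> Ia; apply: extremality_cleared => [t|i||t|t|].
  - exact: DN0.
  - exact: GN0.
  - exact: BN0.
  - apply: filterS (open_nbhs_nbhs (conj (oI t) (Iz a t Ia))) => u Iu.
    by have [_ /(_ 0%N)] := smooth t u Iu.
  - by have [_ /(_ 1%N)] := smooth t _ (Iz a t Ia).
  - by apply: E => t; exact: Iz.
pose l := ell Gam beta s.
have [a0 Ia0] := I0 s.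
(* The conditions on t and n sit under the existential, with 0 as a dummy elsewhere, so that
   [choice] yields one family of quotients. *)
have quo t n : exists q : {poly R}, t != s -> (n < 3)%N ->
    (size q <= l.+1)%N /\ forall a, I s a ->
      peval (coefs Gam beta s t)`_n (z a) / peval (Delta R t) (z a) = q.[a].
  have [->|ts] := eqVneq t s; first by exists 0.
  have [n3|_] := ltnP n 3; last by exists 0.
  have cl : (coefs Gam beta s t)`_n \in coefs Gam beta s t by rewrite mem_nth.
  have [|q sq qE] := coefs_quotient ts cl (y := y).
    by apply: contraNneq (DN0 a0 t Ia0) => D0; rewrite -horner_upoly D0 horner0.
  exists q => _ _; split=> // a Ia; rewrite -!horner_upoly qE hornerM mulfK //.
  by rewrite horner_upoly DN0.
have [q qP] := choice (fun tn => quo tn.1 tn.2).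
(* For the term at s, Delta_s cancels entirely and the power of G_p, free of x_s, is a non-zero
   constant by which the equation is divided. *)
pose gam := peval (xGam Gam (grpof s)) y ^+ (d (grpof s)).-1.
have Gs a : peval (xGam Gam (grpof s)) (z a) = peval (xGam Gam (grpof s)) y.
  apply: eq_peval_xGam => u us; rewrite /z /=; case: eqP => // uE.
  by rewrite uE eqxx in us.
have gamN0 : gam != 0 by rewrite expf_neq0 // -(Gs a0) GN0.
pose Q := gam^-1 *: (upoly s y (rhs Gam s alpha) -
  \sum_(t | t != s) \sum_(n < 3) derive1n n (A t) (y t) *: q (t, n : nat)).
have sQ : (size Q <= l.+1)%N.
  apply: leq_trans (size_scale_leq _ _) _.
  apply: leq_trans (size_polyD _ _) _; rewrite size_polyN geq_max; apply/andP; split.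
    by apply: leq_trans (size_upoly_le _ _ _) _; rewrite ltnS pdeg_rhs_ell.
  apply: (big_ind (fun p : {poly R} => size p <= l.+1)%N); first by rewrite size_poly0.
    by move=> p1 p2 h1 h2; apply: leq_trans (size_polyD _ _) _; rewrite geq_max h1.
  move=> t ts; apply: (big_ind (fun p : {poly R} => size p <= l.+1)%N).
  - by rewrite size_poly0.
  - by move=> p1 p2 h1 h2; apply: leq_trans (size_polyD _ _) _; rewrite geq_max h1.
  move=> n _; apply: leq_trans (size_scale_leq _ _) _.
  by have [] := qP (t, n : nat) ts (ltn_ord n).
pose c n := (leibniz_coefs s (mu beta) P)`_n.
have ode a : I s a ->
    (upoly s y (c 0%N)).[a] * A s a + (upoly s y (c 1%N)).[a] * derive1n 1 (A s) a
    + (upoly s y (c 2)).[a] * derive1n 2 (A s) a = Q.[a].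
  move=> Ia; have := eqn a Ia; rewrite (bigD1 s) //=.
  rewrite (eq_bigr (fun t => \sum_(n < 3) derive1n n (A t) (y t) * (q (t, n : nat)).[a])).
    rewrite zs => /(canRL (addrK _)) h.
    have sumE : (\sum_(t | t != s) \sum_(n < 3)
        derive1n n (A t) (y t) *: q (t, n : nat)).[a] =
        \sum_(t | t != s) \sum_(n < 3) derive1n n (A t) (y t) * (q (t, n : nat)).[a].
      rewrite horner_sum; apply: eq_bigr => t _; rewrite horner_sum.
      by apply: eq_bigr => n _; rewrite hornerZ.
    rewrite /Q hornerZ hornerD hornerN sumE !horner_upoly -!/(z a) -h.
    rewrite !big_ord_recl big_ord0 !coefs_nth // -/P -!/(c _) !pevalM !pevalX !Gs -/gam.
    rewrite /=; field.
    by rewrite gamN0 DN0.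
  move=> t ts; rewrite mulr_suml; apply: eq_bigr => n _.
  have [_ <-] := qP (t, n : nat) ts (ltn_ord n); last by [].
  by rewrite zt //; ring.
have sb : (size (upoly s y (mu beta)) <= 2)%N.
  by apply: leq_trans (size_upoly_le _ _ _) _; rewrite ltnS pdeg_mu_le.
have ell_le : (l <= dsum d)%N.
  by apply: (@ell_le_dsum _ _ _ _ _ d_gt0 s (z a0)) => t; exact: DN0.
have [c0 c1 c2] := upoly_leibniz P sb.
have dA : derivs_on (I s) (A s) (fun n => derive1n n (A s)).
  split=> // n a Ia; rewrite derive1nS derive1E; apply/derivableP.
  by have [_] := smooth s a Ia.
have [|a Ia|a Ia|M [MA sM sMb]] := @ode_poly R (I s) (A s) _ (upoly s y (mu beta))
  (upoly s y P) Q (dsum d + 1) (iI s) (oI s) (I0 s) dA sb.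
- by apply: leq_trans sQ _; rewrite addn1 ltnS.
- by rewrite horner_upoly BN0.
- by rewrite -c0 -c1 -c2 -ode.
exists M; split=> //; first by rewrite !addn2 in sM *; rewrite addn1 in sM.
move=> dB; have /sMb : (upoly s y (mu beta))^`() = 0.
  by rewrite -upoly_pderiv dB; exact: rmorph0.
by move=> /leq_trans; apply; rewrite -addSn leq_add2r.
Qed.

End ClearedEquation.

(** * Moving roots and the factorization of the numerator *)

Local Open Scope classical_set_scope.
Local Open Scope ring_scope.

Section PolyProducts.
Variable R : realType.

Lemma size_prod_exp (J : finType) (A : pred J) (g : J -> {poly R}) (n : J -> nat) :
  (forall j, A j -> size (g j) = 2%N) ->
  size (\prod_(j | A j) g j ^+ n j) = (\sum_(j | A j) n j).+1.
Proof.
move=> sg; suff [] : size (\prod_(j | A j) g j ^+ n j) = (\sum_(j | A j) n j).+1 /\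
  \prod_(j | A j) g j ^+ n j != 0 by [].
apply: (big_ind2 (fun (p : {poly R}) m => size p = m.+1 /\ p != 0)).
- by rewrite size_poly1 oner_neq0.
- move=> p m q m' [sp p0] [sq q0]; rewrite size_mul // sp sq mulf_neq0 //.
  by rewrite addnS.
move=> j Aj; have g0 : g j != 0 by rewrite -size_poly_eq0 sg.
split; last exact: expf_neq0.
have gn0 : (0 < size (g j ^+ n j))%N by rewrite lt0n size_poly_eq0 expf_neq0.
by rewrite -(prednK gn0) size_exp sg // mul1n.
Qed.

Lemma coprimep_prod_exp (J : finType) (A : pred J) (g h : J -> {poly R}) (n : J -> nat) :
  (forall i j, A i -> A j -> coprimep (g i) (h j)) ->
  coprimep (\prod_(j | A j) g j ^+ n j) (\prod_(j | A j) h j ^+ n j).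
Proof.
move=> gh; apply: (big_ind (fun p => coprimep p _)).
- exact: coprime1p.
- by move=> p q hp hq; rewrite coprimepMl hp.
move=> i Ai; apply: coprimep_expl; apply: (big_ind (fun p => coprimep _ p)).
- exact: coprimep1.
- by move=> p q hp hq; rewrite coprimepMr hp.
by move=> j Aj; apply: coprimep_expr; apply: gh.
Qed.

End PolyProducts.

Section Factors.
Local Open Scope classical_set_scope.
Local Open Scope ring_scope.
Variables (R : realType) (k : nat) (d : 'I_k -> nat) (Gam : factors R d).
Implicit Types (x y z : slot d -> R) (s t : slot d) (j : 'I_k).

(** Each G_j with j outside the group of s is of one of three kinds: a constant times the form of
    e_j, a moving factor left as it is, or a constant in x_s. Non-vanishing at one point [a] makes
    all these constants non-zero. *)
Lemma prod_xGam_factor s (e : 'I_k -> 'rV[R]_2) y a :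
  (forall j, j \in Oset Gam s -> decomposes_with Gam (grpof s) j (e j)) ->
  (forall j, peval (xGam Gam j) [eta y with s |-> a] != 0) ->
  exists2 c, c != 0 & upoly s y (\prod_(b | b != grpof s) xGam Gam b ^+ d b) =
    c *: (\prod_(j in Oset Gam s)
             ((e j ord0 ord0)%:P + (e j ord0 ord_max) *: 'X) ^+ d j *
          \prod_(j in Obar Gam s :\: Oset Gam s) upoly s y (xGam Gam j) ^+ d j).
Proof.
move=> he GN0.
pose lin j : {poly R} := (e j ord0 ord0)%:P + (e j ord0 ord_max) *: 'X.
pose E j : {poly R} := if j \in Oset Gam s then lin j ^+ d j else 1.
pose H j : {poly R} := if j \in Obar Gam s :\: Oset Gam s
  then upoly s y (xGam Gam j) ^+ d j else 1.
have split_factor j : exists c, j != grpof s -> c != 0 /\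
    upoly s y (xGam Gam j) ^+ d j = c%:P * (E j * H j).
  have [->|js] := eqVneq j (grpof s); first by exists 0.
  rewrite /E /H finset.in_setD; have [jO|jO] := boolP (j \in Oset Gam s) => /=.
    have [c cE] := decomposes_factor y (he j jO) js.
    have up : upoly s y (xGam Gam j) = c%:P * lin j.
      apply/subr0_eq/(poly_eq0_itv (@ltr01 R)) => b _.
      by rewrite hornerD hornerN horner_upoly cE /lin !hornerE [b * _]mulrC subrr.
    exists (c ^+ d j) => _; split; last by rewrite up exprMn mulr1 polyC_exp.
    apply: expf_neq0; apply: contraNneq (GN0 j) => c0.
    by rewrite cE c0 mul0r.
  have [jb|jb] := boolP (j \in Obar Gam s).
    by exists 1 => _; rewrite oner_neq0 !mul1r.
  have j0 : pdeg s (xGam Gam j) = 0%N.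
    move: jb; rewrite finset.inE js /=; have := pdeg_xGam_le Gam s j; rewrite js.
    by case: (pdeg s _) => [|[|]].
  exists (peval (xGam Gam j) [eta y with s |-> a] ^+ d j) => _; split.
    exact: expf_neq0.
  by rewrite (upoly_pdeg0 y a j0) !mulr1 polyC_exp.
have [c cP] := choice split_factor.
exists (\prod_(b | b != grpof s) c b).
  by apply/prodf_neq0 => b bs; have [] := cP b bs.
rewrite upoly_prod (eq_bigr (fun b => (c b)%:P * (E b * H b))); last first.
  by move=> b bs; rewrite upolyX; have [] := cP b bs.
have restrict (S : {set 'I_k}) (F : 'I_k -> {poly R}) : S \subset Obar Gam s ->
    \prod_(b | b != grpof s) (if b \in S then F b else 1) = \prod_(b in S) F b.
  move=> /fintype.subsetP SO; rewrite [LHS]big_mkcond [RHS]big_mkcond.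
  apply: eq_bigr => b _; case: ifP => // /negbFE /eqP bs; case: ifP => // /SO.
  by rewrite finset.inE bs eqxx.
rewrite big_split big_split /= -(rmorph_prod (@polyC R)) mul_polyC; congr (_ *: (_ * _)); apply: restrict.
  by apply/fintype.subsetP => j; rewrite finset.inE => /andP[].
exact: finset.subsetDl.
Qed.

(** The point y1 makes every x_s-derivative non-zero, so each G_j has there exactly one root r_j in
    x_s. Then y2 is chosen so that no G_j vanishes at any r_i. This is possible in the box, for
    otherwise G_j would vanish identically on x_s = r_i and [decomposes_of_root] would put j in
    [Oset]. *)
Lemma moving_roots (I : slot d -> set R) s : segre_veronese Gam ->
  (forall t, [/\ open (I t), is_interval (I t) & I t !=set0]) ->
  exists y1 y2 : slot d -> R,
    [/\ forall t, I t (y1 t), forall t, I t (y2 t),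
        forall j, j \in Obar Gam s :\: Oset Gam s ->
          size (upoly s y1 (xGam Gam j)) = 2%N &
        forall i j, i \in Obar Gam s :\: Oset Gam s ->
          j \in Obar Gam s :\: Oset Gam s ->
          coprimep (upoly s y1 (xGam Gam i)) (upoly s y2 (xGam Gam j))].
Proof.
move=> hGam oiI; set S := Obar Gam s :\: Oset Gam s.
have oI t : open (I t) by case: (oiI t).
have I0 t : I t !=set0 by case: (oiI t).
have iI t : is_interval (I t) by case: (oiI t).
pose box (x : slot d -> R) := forall t, I t (x t).
have cbox : convex_set box := box_convex iI.
have box0 : exists x, box x := box_nonempty I0.
have SP j : j \in S -> [/\ j \notin Oset Gam s, j != grpof s & pdeg s (xGam Gam j) = 1%N].
  by rewrite finset.in_setD => /andP[-> ]; rewrite finset.inE => /andP[-> /eqP].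
have [y1 Iy1 y1N0] : exists2 x, box x & forall j : 'I_k,
    (if j \in S then peval (pderiv s (xGam Gam j)) else fun=> 1) x != 0.
  apply: line_polynomial_common_neq0 => // j; case: ifP => jS.
  - exact: peval_line_polynomial.
  - by move=> y z; exists 1 => a; rewrite hornerC.
  - apply: line_polynomial_box_neq0 => //; first exact: peval_line_polynomial.
    by apply: xGam_pderiv_neq0; have [_ _ ->] := SP j jS.
  - by have [x bx] := box0; exists x => //; exact: oner_neq0.
pose r j : R := - (upoly s y1 (xGam Gam j))`_0 / (upoly s y1 (xGam Gam j))`_1.
have size2 j : j \in S -> size (upoly s y1 (xGam Gam j)) = 2%N.
  move=> jS; apply/eqP; rewrite eqn_leq; apply/andP; split.
    by apply: leq_trans (size_upoly_le _ _ _) _; have [_ _ ->] := SP j jS.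
  rewrite ltnNge; apply/negP => s1; have := y1N0 j; rewrite jS.
  rewrite -[X in peval _ X](eta_with_id y1 s) -horner_upoly upoly_pderiv.
  by rewrite (size1_polyC s1) derivC horner0 eqxx.
have factor j : j \in S -> upoly s y1 (xGam Gam j) =
    (upoly s y1 (xGam Gam j))`_1 *: ('X - (r j)%:P).
  move=> jS; have sj := size2 j jS; have lN0 : (upoly s y1 (xGam Gam j))`_1 != 0.
    have := lead_coef_eq0 (upoly s y1 (xGam Gam j)); rewrite /lead_coef sj /= => ->.
    by rewrite -size_poly_eq0 sj.
  apply/polyP => -[|[|i]]; rewrite coefZ coefB coefX coefC /=.
  - by rewrite sub0r /r mulNr opprK mulrCA mulfV // mulr1.
  - by rewrite subr0 mulr1.
  - by rewrite subr0 mulr0 nth_default // sj.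
have [y2 Iy2 y2N0] : exists2 x, box x & forall ij : 'I_k * 'I_k,
    (if (ij.1 \in S) && (ij.2 \in S)
     then fun x => peval (xGam Gam ij.2) [eta x with s |-> r ij.1] else fun=> 1) x != 0.
  apply: line_polynomial_common_neq0 => // -[i j] /=.
    case: ifP => _; last by move=> y z; exists 1 => a; rewrite hornerC.
    exact: peval_eta_line_polynomial.
  case: ifP => [/andP[iS jS]|_]; last by have [x bx] := box0; exists x => //; exact: oner_neq0.
  apply: line_polynomial_box_neq0 => //; first exact: peval_eta_line_polynomial.
  have [jO js j1] := SP j jS.
  apply: contrapT => nx; move/negP: jO; apply; rewrite finset.inE.
  rewrite finset.inE js j1 eqxx /=; apply/asboolP.
  apply: (@decomposes_of_root _ _ _ _ s j (r i)) => // x xs.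
  apply/eqP/negPn/negP => Gx; apply: nx; exists x.
  by rewrite -xs eta_with_id.
exists y1, y2; split=> // i j iS jS.
have aN0 : (upoly s y1 (xGam Gam i))`_1 != 0.
  by apply/eqP => a0; have := size2 i iS; rewrite (factor i iS) a0 scale0r size_poly0.
rewrite (factor i iS) coprimepZl // coprimep_sym coprimep_XsubC.
by rewrite /root horner_upoly; have := y2N0 (i, j); rewrite /= iS jS.
Qed.

End Factors.

Theorem proposition3p1p2 (R : realType) (k : nat) (d : 'I_k -> nat)
    (Gam : factors R d) (hGam : segre_veronese Gam)
    (beta : tensor R (slot d)) (beta_h : beta \in hspace Gam)
    (beta_neq0 : beta != 0)
    (I : slot d -> set R) (A : slot d -> R -> R)
    (hA : extremal_solution Gam beta I A)
    (s : slot d) (e : 'I_k -> 'rV[R]_2)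
    (he : forall j, j \in Oset Gam s -> decomposes_with Gam (grpof s) j (e j)) :
  exists N : {poly R},
    [/\ forall t : R, I s t ->
          A s t = N.[t] /
            \prod_(j in Oset Gam s) (e j ord0 ord0 + t * e j ord0 ord_max) ^+ d j,
        (size N + \sum_(j in Obar Gam s :\: Oset Gam s) d j <= (dsum d + 2).+1)%N &
        pderiv s (mu beta) = 0 ->
        (size N + \sum_(j in Obar Gam s :\: Oset Gam s) d j
           <= (ell Gam beta s + 2).+1)%N].
Proof.
have [_ d_gt0 _ _ _] := hGam; have [oiI smooth nz _] := hA.
have [oI iI I0] := oiI s.
have [y1 [y2 [Iy1 Iy2 size2 cop]]] := moving_roots s hGam oiI.
pose E : {poly R} := \prod_(j in Oset Gam s)
  ((e j ord0 ord0)%:P + (e j ord0 ord_max) *: 'X) ^+ d j.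
pose H y : {poly R} := \prod_(j in Obar Gam s :\: Oset Gam s) upoly s y (xGam Gam j) ^+ d j.
have EE t : E.[t] = \prod_(j in Oset Gam s) (e j ord0 ord0 + t * e j ord0 ord_max) ^+ d j.
  by rewrite horner_prod; apply: eq_bigr => j _; rewrite horner_exp !hornerE [t * _]mulrC.
have [a0 Ia0] := I0.
have numer y : (forall t, I t (y t)) -> exists c, exists M : {poly R},
    [/\ c != 0, forall a, I s a -> A s a * (c * (E.[a] * (H y).[a])) = M.[a],
      forall a, I s a -> E.[a] * (H y).[a] != 0,
      (size M <= (dsum d + 2).+1)%N &
      pderiv s (mu beta) = 0 -> (size M <= (ell Gam beta s + 2).+1)%N].
  move=> Iy; have GN0 a j : I s a -> peval (xGam Gam j) [eta y with s |-> a] != 0.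
    move=> Ia; have [|_ /(_ j) //] := nz [eta y with s |-> a].
    by move=> t /=; case: eqP => // ->.
  have [c c0 cE] := prod_xGam_factor he (fun j => GN0 a0 j Ia0).
  have [M [MA sM sMb]] := extremal_numerator d_gt0 s hA Iy.
  exists c, M; split=> // a Ia; first by rewrite -MA // cE hornerZ hornerM.
  have PN0 : (upoly s y (\prod_(b | b != grpof s) xGam Gam b ^+ d b)).[a] != 0.
    rewrite horner_upoly peval_prod; apply/prodf_neq0 => b _.
    by rewrite pevalX expf_neq0 // GN0.
  by apply: contraNneq PN0 => EH0; rewrite cE hornerZ hornerM EH0 mulr0.
have [c1 [M1 [c10 M1A EH1 sM1 sM1b]]] := numer y1 Iy1.
have [c2 [M2 [c20 M2A _ _ _]]] := numer y2 Iy2.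
have cross : M1 * (c2 *: H y2) = M2 * (c1 *: H y1).
  apply: (poly_eq_open oI I0) => t It.
  by rewrite !hornerM !hornerZ -M1A // -M2A //; ring.
have dvd : H y1 %| M1.
  have : coprimep (H y1) (H y2) by exact: coprimep_prod_exp.
  move=> /Gauss_dvdpl <-; rewrite -(dvdpZr _ _ c20) scalerAr cross -scalerAr.
  by rewrite dvdpZr // dvdp_mull.
pose N := c1^-1 *: (M1 %/ H y1).
have M1E : M1 = (c1 *: N) * H y1 by rewrite scalerA mulfV // scale1r divpK.
have sH : size (H y1) = (\sum_(j in Obar Gam s :\: Oset Gam s) d j).+1.
  exact: size_prod_exp.
have HN0 : H y1 != 0 by rewrite -size_poly_eq0 sH.
have AE t : I s t -> A s t * E.[t] = N.[t].
  move=> It; have := EH1 t It; rewrite mulf_eq0 negb_or => /andP[_ Ht].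
  apply: (mulfI c10); apply: (mulIf Ht).
  by have := M1A t It; rewrite M1E hornerM hornerZ => <-; ring.
(* The size of a product is additive only for non-zero factors; here the non-vanishing of A_s is
   what excludes N = 0. *)
have NN0 : N != 0.
  apply: contraTneq (EH1 a0 Ia0) => N0; have := AE a0 Ia0; rewrite N0 horner0 => /eqP.
  have [A0 _] := smooth s a0 Ia0.
  by rewrite mulf_eq0 (negbTE A0) => /eqP ->; rewrite mul0r eqxx.
have sN : (size N + \sum_(j in Obar Gam s :\: Oset Gam s) d j)%N = size M1.
  by rewrite [in RHS]M1E -scalerAl [RHS]size_scale // size_mul // sH addnS.
exists N; rewrite sN; split=> // t It.
rewrite -AE // -EE mulfK //.
by have := EH1 t It; rewrite mulf_eq0 negb_or => /andP[].
Qed.
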